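(* Let $d\ge 1$ and $k\ge 1$ be integers. Let $G'$ be a minimally $d$-rigid graph and let $H$ be a minimally $d$-rigid subgraph of $G'$ with at least $d$ vertices. Let $G$ be the graph obtained by taking $k$ vertex-disjoint copies of $G'$ and identifying the $k$ copies of $H$ (gluing the $k$ copies of $G'$ along $H$), and suppose $G$ is minimally $d$-rigid. Then $$\lambda_d(G)=\lambda_d(H)\cdot\left(\frac{\lambda_d(G')}{\lambda_d(H)}\right)^{k}.$$
   Context: A realization of a graph $G=(V,E)$ in $\mathbb{R}^d$ is a map $\rho\colon V\to\mathbb{R}^d$. $G$ is (generically) $d$-rigid if for every generic realization $\rho$ (coordinates algebraically independent over $\mathbb{Q}$) there is $\varepsilon>0$ such that every realization $\rho'$ with $\|\rho'(u)-\rho'(v)\|=\|\rho(u)-\rho(v)\|$ for all edges $uv$ and $\|\rho(v)-\rho'(v)\|<\varepsilon$ for all $v$ is congruent to $\rho$ (all pairwise distances agree). $G$ is minimally $d$-rigid if it is $d$-rigid and deleting any edge destroys $d$-rigidity. For a minimally $d$-rigid graph $G=(V,E)$, $\lambda_d(G)$ denotes the number of complex realizations $\rho\colon V\to\mathbb{C}^d$ with $\|\rho(u)-\rho(v)\|^2=\ell_{uv}$ for all $uv\in E$, for a generic choice of the values $(\ell_{uv})_{uv\in E}$, counted modulo translations and complex rotations (the action of $SO(d,\mathbb{C})$), where $\|x\|^2=\sum_i x_i^2$ is the complex-bilinear extension of the squared norm. Reflections are counted as distinct realizations (e.g. a triangle has $\lambda_2=2$). Equivalently, $\lambda_d(G)$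 is the degree of the edge-length map restricted to realizations with $\rho(v_k)_j=0$ for $j\ge k$ for fixed vertices $v_1,\dots,v_d$. *)

(* Defs.v *)
From mathcomp Require Import all_boot all_order all_algebra.
From mathcomp Require Import boolp classical_sets cardinality reals complex.
From mathcomp Require Import mpoly.
Set Implicit Arguments.
Unset Strict Implicit.
Unset Printing Implicit Defensive.
Import Order.TTheory GRing.Theory Num.Theory.
Local Open Scope ring_scope.

Record graph (V : finType) := Graph {
  edges : {set {set V}};
  edges_card2 : forall e, e \in edges -> #|e| = 2%N }.

Section DeleteEdge.
Variables (V : finType) (G : graph V) (e : {set V}).

Lemma delete_edge_subproof f : f \in edges G :\ e -> #|f| = 2%N.
Proof. by case/setD1P=> _; exact: edges_card2. Qed.

Definition delete_edge : graph V := Graph delete_edge_subproof.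
End DeleteEdge.

(* Subgraphs are not required to be induced, nor spanning. *)
Record subgraph (V : finType) (G : graph V) := Subgraph {
  sverts : {set V};
  sedges : {set {set V}};
  sedges_sub : sedges \subset edges G;
  sedges_verts : forall e, e \in sedges -> e \subset sverts }.

Section GraphOf.
Variables (V : finType) (G : graph V) (H : subgraph G).

Lemma graph_of_subproof (e : {set {v : V | v \in sverts H}}) :
  e \in [set e : {set {v : V | v \in sverts H}} | val @: e \in sedges H] ->
  #|e| = 2%N.
Proof.
rewrite inE => /(fintype.subsetP (sedges_sub H))/edges_card2.
by rewrite card_imset //; exact: val_inj.
Qed.

(* H as a graph in its own right, on the type of its own vertices. *)
Definition graph_of : graph {v : V | v \in sverts H} :=
  Graph graph_of_subproof.
End GraphOf.

Section Glue.
Variables (k : nat) (V : finType) (G : graph V) (H : subgraph G).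

(* One shared copy of V(H), and k disjoint copies of V(G) minus V(H). *)
Definition glue_vert : finType :=
  ({v : V | v \in sverts H} + 'I_k * {v : V | v \notin sverts H})%type.

Definition copy (i : 'I_k) (v : V) : glue_vert :=
  match decP (@idP (v \in sverts H)) with
  | left h => inl (exist _ v h)
  | right h => inr (i, exist _ v (introT negP h))
  end.

Lemma copyP i j u v :
  copy i u = copy j v <-> u = v /\ (i = j \/ u \in sverts H).
Proof.
rewrite /copy; case: (decP _) => hu; case: (decP _) => hv.
- split=> [[->]|[uv _]]; first by split=> //; right.
  by congr inl; apply: val_inj.
- by split=> // -[uv _]; case: hv; rewrite -uv.
- by split=> // -[uv _]; case: hu; rewrite uv.
- split=> [[-> ->]|[uv [-> |//]]]; first by split=> //; left.
  by congr inr; congr pair; apply: val_inj.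
Qed.

Lemma copy_inj i : injective (copy i).
Proof. by move=> u v /copyP[]. Qed.

Lemma copy_surj (x : glue_vert) : (0 < k)%N -> exists i v, x = copy i v.
Proof.
move=> k0; case: x => [[v hv]|[i [v hv]]].
  exists (Ordinal k0), v; rewrite /copy; case: (decP _) => // h.
  by congr inl; apply: val_inj.
exists i, v; rewrite /copy; case: (decP _) => h; first by case/negP: (hv).
by congr inr; congr pair; apply: val_inj.
Qed.

Definition glue_edges : {set {set glue_vert}} :=
  \bigcup_(i < k) [set copy i @: (e : {set V}) | e in edges G].

Lemma glue_subproof e : e \in glue_edges -> #|e| = 2%N.
Proof.
case/bigcupP=> i _ /imsetP[f /edges_card2 <- ->].
by rewrite card_imset //; exact: copy_inj.
Qed.

Definition glue : graph glue_vert := Graph glue_subproof.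
End Glue.

Definition alg_independent (K : fieldType) (I : finType) (x : I -> K) : Prop :=
  forall p : {mpoly rat[#|I|]},
    mmap (ratr : rat -> K) (fun i => x (enum_val i)) p = 0 -> p = 0.

(* Over the complex numbers this is the bilinear, not the Hermitian, square. *)
Definition sqnorm (K : fieldType) (d : nat) (x : 'rV[K]_d) : K :=
  \sum_i x 0 i ^+ 2.

(* The library norm on row vectors is the sup norm, hence this one. *)
Definition eucl_norm (R : rcfType) (d : nat) (x : 'rV[R]_d) : R :=
  Num.sqrt (sqnorm x).

Section Rigidity.
Variables (R : realType) (d : nat) (V : finType).
Implicit Types (G : graph V) (rho : V -> 'rV[R]_d).

Definition generic_realization rho : Prop :=
  alg_independent (fun vj : V * 'I_d => rho vj.1 0 vj.2).

Definition same_dist rho rho' (u v : V) : Prop :=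
  eucl_norm (rho' u - rho' v) = eucl_norm (rho u - rho v).

Definition rigid G : Prop :=
  forall rho, generic_realization rho ->
    exists2 eps : R, 0 < eps &
      forall rho',
        (forall u v, [set u; v]%SET \in edges G -> same_dist rho rho' u v) ->
        (forall v, eucl_norm (rho v - rho' v) < eps) ->
        forall u v, same_dist rho rho' u v.

Definition min_rigid G : Prop :=
  rigid G /\ forall e, e \in edges G -> ~ rigid (delete_edge G e).
End Rigidity.

Section RealizationNumber.
Variables (d : nat) (V : finType) (G : graph V).

Definition realizations (K : fieldType)
    (l : {e : {set V} | e \in edges G} -> K) : set (V -> 'rV[K]_d) :=
  [set rho | forall e u v, val e = [set u; v]%SET ->
               sqnorm (rho u - rho v) = l e].

(* Row-vector convention: x is mapped to x A + b with A in SO(d, K). *)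
Definition directly_congruent (K : fieldType) (rho rho' : V -> 'rV[K]_d) : Prop :=
  exists (A : 'M[K]_d) (b : 'rV[K]_d),
    [/\ A *m A^T = 1%:M, \det A = 1 & forall v, rho' v = rho v *m A + b].

Definition realization_classes (K : fieldType)
    (l : {e : {set V} | e \in edges G} -> K) : set (set (V -> 'rV[K]_d)) :=
  ((fun rho => [set rho' | directly_congruent rho rho']) @`
     realizations l)%classic.

(* The common number of classes for all l algebraically independent over Q;
   when there is no such (finite) number, the value is the dummy 0. *)
Definition realization_number (R : rcfType) : nat :=
  xget 0%N [set N : nat | forall l : {e : {set V} | e \in edges G} -> R[i]%C,
    alg_independent l -> (realization_classes l #= `I_N)%card]%classic.
End RealizationNumber.

(* Main.v *)
Require Import Defs.
From mathcomp Require Import all_boot all_order all_algebra.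
From mathcomp Require Import reals.
From mathcomp Require Import boolp classical_sets cardinality complex.
From mathcomp Require Import mpoly ring lra.
Set Implicit Arguments.
Unset Strict Implicit.
Unset Printing Implicit Defensive.
Import Order.TTheory GRing.Theory Num.Theory.
Local Open Scope ring_scope.

(** Write K for the complex numbers.  Classes of realizations of G (and of G')
    fibre over the classes of realizations of H: the differences of d of the
    points of a realization rho of H with generic lengths span a nondegenerate
    hyperplane, so no nontrivial direct isometry fixes rho, and the fibre over
    the class of rho is the set of extensions of rho.  For G this set is the
    product, over the k copies, of the sets of extensions of rho to G'.  Hence
    all that is needed is that the number of extensions of rho to G', for
    lengths l of the edges of G', is the same for all pairs (rho, l) with l
    generic.

    Rigidity of H makes every squared distance algebraic over the squared edge
    lengths (a flex that is infinitesimally nontrivial at a generic real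
    placement would integrate to an actual flex).  So, for all compatible pairs
    (rho, l) with l generic, the squared distances of rho together with l
    satisfy the same polynomial relations over Q.  As K is algebraically closed
    and uncountable, any finite configuration over (rho, l) can be copied over
    (rho', l') with the same relations; this turns N extensions of rho into N
    extensions of a placement with the same distances as rho', that is, of an
    isometric (possibly reflected) image of rho'. *)

(** * Transcendental elements and generic points *)

Section Uncountable.
Local Open Scope classical_set_scope.

(** Nested intervals: stage [n] excludes the real with code [n], and the supremum of the left ends
    survives every stage, including that of its own code. *)
Lemma real_uncountable (R : realType) : ~ countable [set: R].
Proof.
move/countable_injP => [c cinj].
have ci x y : c x = c y -> x = y by apply: cinj; rewrite in_setE.
pose good n (p q : R * R) := [/\ p.1 <= q.1, q.2 <= p.2, q.1 < q.2 &
  forall x, c x = n -> x < q.1 \/ q.2 < x].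
have step n (p : R * R) : p.1 < p.2 -> exists q, good n p q.
  case: p => a b /= ab; set m := (a + b) / 2%:R.
  have am : a < m by rewrite midf_lt.
  have mb : m < b by rewrite midf_lt.
  have [[x cx]|nex] := pselect (exists x, c x = n); last first.
    by exists (a, b); split=> //= x cx; case: nex; exists x.
  set m1 := (a + m) / 2%:R; set m2 := (m + b) / 2%:R.
  (* The outer quarter across the midpoint from [x] is kept; staying off the midpoint leaves [x]
     strictly outside even if [x = m]. *)
  have [xm|mx] := leP x m.
    exists (m2, b); split=> /=; rewrite ?midf_lt //.
      by apply/ltW/(lt_trans am); rewrite midf_lt.
    move=> y; rewrite -cx => /ci ->; left.
    by apply: (le_lt_trans xm); rewrite midf_lt.
  exists (a, m1); split=> /=; rewrite ?midf_lt //.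
    by apply/ltW/(lt_trans _ mb); rewrite midf_lt.
  move=> y; rewrite -cx => /ci ->; right.
  by apply: lt_trans mx; rewrite midf_lt.
have /choice[F FP] (np : nat * (R * R)) :
    exists q, np.2.1 < np.2.2 -> good np.1 np.2 q.
  have [/(step np.1)[q qP]|_] := ltP np.2.1 np.2.2; first by exists q.
  by exists (0, 0).
pose s := fix s n := if n is n'.+1 then F (n', s n') else (0, 1) : R * R.
have slt n : (s n).1 < (s n).2.
  by elim: n => [|n /(FP (n, s n))[]] //=; exact: ltr01.
have sP n : good n (s n) (s n.+1) by exact: (FP (n, s n) (slt n)).
have mono1 n m : (n <= m)%N -> (s n).1 <= (s m).1.
  elim: m => [|m ih]; first by rewrite leqn0 => /eqP ->.
  rewrite leq_eqVlt => /predU1P[-> //|/ih h].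
  by apply: le_trans h _; case: (sP m).
have mono2 n m : (n <= m)%N -> (s m).2 <= (s n).2.
  elim: m => [|m ih]; first by rewrite leqn0 => /eqP ->.
  rewrite leq_eqVlt => /predU1P[-> //|/ih h].
  by apply: le_trans h; case: (sP m).
have cross n m : (s n).1 <= (s m).2.
  apply: le_trans (mono1 _ (maxn n m) (leq_maxl _ _)) _.
  exact: le_trans (ltW (slt _)) (mono2 _ _ (leq_maxr _ _)).
pose A := range (fun n => (s n).1).
have supA : has_sup A.
  by split; [exists (s 0).1, 0 | exists (s 0).2 => _ [n _ <-]].
pose x := sup A.
have x1 n : (s n).1 <= x by apply: ub_le_sup supA.2 _ _; exists n.
have x2 n : x <= (s n).2.
  by apply: ge_sup; [case: supA | move=> _ [k _ <-]].
case: (sP (c x)) => _ _ _ /(_ x erefl).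
by case=> [/lt_geF|/lt_geF]; [rewrite x1 | rewrite x2].
Qed.

Lemma countable_poly (A : nzRingType) :
  countable [set: A] -> countable [set: {poly A}].
Proof.
move/countable_injP => [h hinj].
apply/countable_injP; exists (fun p : {poly A} => pickle (map h p)) => p q _ _.
move/(pcan_inj pickleK)/inj_map => pq; apply/val_inj/pq => x y.
by apply: hinj; rewrite in_setE.
Qed.

Lemma countable_mpoly n : countable [set: {mpoly rat[n]}].
Proof.
apply/countable_injP.
exists (fun p : {mpoly rat[n]} => pickle [seq (p@_m, m) | m <- msupp p]).
move=> p q _ _ /(pcan_inj pickleK) pq.
have e (r : {mpoly rat[n]}) :
    r = \sum_(x <- [seq (r@_m, m) | m <- msupp r]) x.1 *: 'X_[x.2].
  by rewrite big_map /= [LHS]mpolyE.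
by rewrite [LHS]e pq -e.
Qed.

Lemma finite_roots (F : fieldType) (p : {poly F}) :
  p != 0 -> finite_set [set x | root p x].
Proof.
move=> p0; apply: contrapT => /(@infinite_set_fset _ _ (size p)) [s sp].
rewrite leqNgt => /negP; apply.
apply: (max_poly_roots p0); last exact: finmap.fset_uniq.
by apply/allP => x /sp.
Qed.

(** The elements algebraic over the image of [g] form a countable union of finite root sets, so they
    cannot exhaust [F]. *)
Lemma transcendental_exists (F : fieldType) (A : nzRingType)
    (g : {rmorphism A -> F}) :
  ~ countable [set: F] -> countable [set: A] ->
  exists c, forall p : {poly A}, root (map_poly g p) c -> map_poly g p = 0.
Proof.
move=> uncF /countable_poly cA; apply: contrapT => nex; apply: uncF.
pose rts (p : {poly A}) := [set c | map_poly g p != 0 /\ root (map_poly g p) c].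
have -> : [set: F] = \bigcup_(p in [set: {poly A}]) rts p.
  apply/seteqP; split=> // c _; apply: contrapT => nc.
  apply: nex; exists c => p rp; apply: contrapT => /eqP np; apply: nc.
  by exists p.
apply: bigcup_countable => // p _; apply: finite_set_countable.
have [p0|np0] := eqVneq (map_poly g p) 0.
  by apply: sub_finite_set (@finite_set0 F) => c []; rewrite p0 eqxx.
by apply: sub_finite_set (finite_roots np0) => c [].
Qed.
End Uncountable.

Section Muni.
Variables (n : nat) (A S : comNzRingType).
Local Notation wd := (widen_ord (leqnSn n)).

Lemma mmap_muni (f : {rmorphism A -> S}) (x : 'I_n.+1 -> S)
    (p : {mpoly A[n.+1]}) :
  mmap f x p = (map_poly (mmap f (x \o wd)) (muni p)).[x ord_max].
Proof.
rewrite muniE rmorph_sum horner_sum; apply: eq_bigr => m _.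
rewrite -mul_polyC rmorphM rmorphXn /= map_polyC map_polyX /=.
rewrite hornerM hornerC hornerXn mmapZ mmapX -mulrA; congr (_ * _).
rewrite /mmap1 big_ord_recr /=; congr (_ * _).
by apply: eq_bigr => i _; rewrite mnmE.
Qed.
End Muni.

Lemma muni_inj n (A : comNzRingType) : injective (@muni n A).
Proof.
have key (p : {mpoly A[n.+1]}) : mmap (@mpolyC n.+1 A) (fun i => 'X_i) p = p.
  rewrite {2}[p]mpolyE /mmap; apply: eq_bigr => m _.
  by rewrite mul_mpolyC mpolyXE_id.
by move=> p q pq; rewrite -[p]key -[q]key !mmap_muni pq.
Qed.

Lemma mpoly0_const (A : nzRingType) (p : {mpoly A[0]}) : p = (p@_0%MM)%:MP.
Proof.
apply/mpolyP => m; rewrite mcoeffC (_ : m = 0%MM) ?eqxx ?mulr1 //.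
by apply/mnmP => -[].
Qed.

(** Induction on [n]: the new coordinate is transcendental over the countable ring generated by the
    previous ones. *)
Lemma exists_indep (F : numFieldType) n : (~ countable [set: F])%classic ->
  exists x : 'I_n -> F, forall p : {mpoly rat[n]}, mmap ratr x p = 0 -> p = 0.
Proof.
move=> unc; elim: n => [|n [x xP]].
  exists (fun=> 0) => p; rewrite [p]mpoly0_const.
  by rewrite mmapC => /eqP; rewrite fmorph_eq0 => /eqP ->; rewrite mpolyC0.
pose g : {rmorphism {mpoly rat[n]} -> F} := mmap ratr x.
have [c cP] := transcendental_exists g unc (countable_mpoly n).
exists (fun i => oapp x c (unlift ord_max i)) => p.
rewrite mmap_muni unlift_none /= => r.
have gE : mmap ratr ((fun i => oapp x c (unlift ord_max i)) \o
    widen_ord (leqnSn n)) =1 g.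
  move=> q; congr mmap; apply/funext => i /=.
  have -> : widen_ord (leqnSn n) i = lift ord_max i.
    by apply/val_inj; rewrite /= /bump leqNgt ltn_ord.
  by rewrite liftK.
rewrite (eq_map_poly gE) in r.
have /cP : root (map_poly g (muni p)) c by rewrite /root r.
move=> /polyP m0; apply: muni_inj; rewrite muni0; apply/polyP => i.
by rewrite coef0; apply: xP; have := m0 i; rewrite coef_map coef0.
Qed.

Lemma exists_alg_independent (F : numFieldType) (I : finType) :
  (~ countable [set: F])%classic -> exists x : I -> F, alg_independent x.
Proof.
move=> /(exists_indep #|I|)[x xP]; exists (x \o enum_rank) => p p0; apply: xP.
rewrite -{}p0; congr mmap; apply/funext => i /=; by rewrite enum_valK.
Qed.

Lemma complex_uncountable (R : realType) : (~ countable [set: R[i]%C])%classic.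
Proof.
move=> /countable_injP[h hinj]; apply: (@real_uncountable R).
apply/countable_injP; exists (fun x => h (real_complex R x)) => x y xt yt e.
by have [] : real_complex R x = real_complex R y by apply: hinj; rewrite ?in_setE.
Qed.

Lemma alg_independent_inj (F : numFieldType) (I J : finType) (x : I -> F)
    (h : J -> I) :
  injective h -> alg_independent x -> alg_independent (x \o h).
Proof.
move=> hinj xP p p0.
pose f (j : 'I_#|J|) : {mpoly rat[#|I|]} := 'X_(enum_rank (h (enum_val j))).
pose q := mmap (@mpolyC #|I| rat) f p.
have q0 : q = 0.
  apply: xP; rewrite -p0 /q [X in mmap _ _ X]/mmap rmorph_sum /=; apply: eq_bigr => m _.
  rewrite rmorphM /= mmapC; congr (_ * _); rewrite /mmap1 rmorph_prod.
  by apply: eq_bigr => i _; rewrite rmorphXn /= mmapX mmap1U enum_rankK.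
(* [g] undoes the renaming [h] and kills the variables outside its image, so [q = 0] gives
   [p = 0]. *)
pose g (i : 'I_#|I|) : {mpoly rat[#|J|]} :=
  if [pick j | enum_rank (h (enum_val j)) == i] is Some j then 'X_j else 0.
have : mmap (@mpolyC #|J| rat) g q = p.
  rewrite /q [X in mmap _ _ X]/mmap rmorph_sum [RHS]mpolyE /=.
  apply: eq_bigr => m _; rewrite rmorphM /= mmapC mul_mpolyC; congr (_ *: _).
  rewrite /mmap1 rmorph_prod mpolyXE_id; apply: eq_bigr => i _.
  rewrite rmorphXn /= mmapX mmap1U /g; case: pickP => [j|/(_ i)]; last by rewrite eqxx.
  by move=> /eqP/enum_rank_inj/hinj/enum_val_inj ->.
by rewrite q0 mmap0.
Qed.

(** * Copying finite configurations *)

(** For ring morphisms: [f a] corresponds to [g a] under an isomorphism of the two images. Kernels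
    avoid subrings and fraction fields. *)
Definition same_kernel (A : nzRingType) (F : fieldType) (f g : A -> F) : Prop :=
  forall a, f a = 0 <-> g a = 0.

Section Transfer.
Variable F : closedFieldType.
Hypothesis uncF : (~ countable [set: F])%classic.

Lemma same_kernel_map_poly (A : idomainType) (f g : {rmorphism A -> F})
    (p : {poly A}) :
  same_kernel f g -> map_poly f p = 0 -> map_poly g p = 0.
Proof.
move=> fg /polyP p0; apply/polyP => i; have := p0 i.
by rewrite !coef_map !coef0 => /fg.
Qed.

(** [q] lifts to [A] a minimal polynomial of [c] over the image of [f]; as [A] need not be a field,
    division by [q] is pseudo-division. *)
Lemma root_reduce (A : idomainType) (f : {rmorphism A -> F}) c p0 :
  map_poly f p0 != 0 -> root (map_poly f p0) c ->
  exists q, [/\ f (lead_coef q) != 0, root (map_poly f q) c,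
    forall p, map_poly f p != 0 -> root (map_poly f p) c ->
      (size q <= size (map_poly f p))%N &
    forall p, root (map_poly f p) c ->
      exists k s r, lead_coef q ^+ k *: p = s * q + r /\ map_poly f r = 0].
Proof.
move=> p00 p0c.
have [n [q1 [q10 q1c q1n]] nmin] : exists2 n,
    exists p, [/\ map_poly f p != 0, root (map_poly f p) c & size (map_poly f p) = n]
  & forall p, map_poly f p != 0 -> root (map_poly f p) c ->
      (n <= size (map_poly f p))%N.
  pose P n := `[< exists p, [/\ map_poly f p != 0, root (map_poly f p) c &
    size (map_poly f p) = n] >].
  have exP : exists n, P n.
    by exists (size (map_poly f p0)); apply/asboolP; exists p0.
  case: (ex_minnP exP) => n /asboolP Pn nmin; exists n => // p pn0 pc.
  by apply: nmin; apply/asboolP; exists p.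
(* The coefficients of [q1] from degree [n] on lie in the kernel of [f]; without them the leading
   coefficient has nonzero image. *)
pose q := take_poly n q1.
have qE : map_poly f q = map_poly f q1.
  apply/polyP => i; rewrite !coef_map coef_take_poly.
  case: ltnP => // ni; rewrite raddf0; apply/esym.
  by rewrite -coef_map nth_default // q1n.
have szq : size q = n.
  by apply/eqP; rewrite eqn_leq size_take_poly /= -{1}q1n -qE size_poly.
have flc : f (lead_coef q) != 0.
  have := q10; rewrite -lead_coef_eq0 -qE lead_coefE qE q1n -qE coef_map /=.
  by rewrite lead_coefE szq.
exists q; split; rewrite ?qE ?szq // => p pc.
have := Pdiv.Idomain.divp_eq p q; set k := Pdiv.IdomainDefs.scalp p q.
set s := Pdiv.IdomainDefs.divp p q; set r := Pdiv.IdomainDefs.modp p q => pE.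
exists k, s, r; split=> //; apply: contraTeq isT => r0.
have q0 : q != 0 by apply: contraNneq flc => ->; rewrite lead_coef0 raddf0.
have /nmin : map_poly f r != 0 by [].
rewrite leqNgt => /(_ _)/negP; case.
  have : root (map_poly f (lead_coef q ^+ k *: p)) c.
    by rewrite linearZ /= rootE hornerZ (rootP pc) mulr0.
  rewrite pE rmorphD rmorphM /= !rootE hornerD hornerM qE (rootP q1c) mulr0.
  by rewrite add0r.
apply: leq_ltn_trans (size_poly _ _) _; rewrite -szq.
by rewrite Pdiv.Idomain.ltn_modp.
Qed.

(** A transcendental [c] is matched with a transcendental [c'], an algebraic one with a root of the
    [g]-image of its minimal polynomial. *)
Lemma same_kernel_root (A : idomainType) (f g : {rmorphism A -> F}) (c : F) :
  (countable [set: A])%classic -> same_kernel f g ->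
  exists c', forall p, root (map_poly f p) c <-> root (map_poly g p) c'.
Proof.
move=> cA fg; have gf : same_kernel g f by move=> a; split=> /fg.
have [[p0 [p00 p0c]]|trc] :=
  pselect (exists p, map_poly f p != 0 /\ root (map_poly f p) c); last first.
  have [c' c'P] := transcendental_exists g uncF cA.
  exists c' => p; split=> [pc|/c'P p0].
    have [p0|p0] := eqVneq (map_poly f p) 0.
      by rewrite (same_kernel_map_poly fg p0) root0.
    by case: trc; exists p.
  by rewrite (same_kernel_map_poly gf p0) root0.
have [q [flc qc qmin qP]] := root_reduce p00 p0c.
have glc : g (lead_coef q) != 0 by apply: contraNneq flc => /fg ->.
have [c' q'c'] : exists c', root (map_poly g q) c'.
  apply/closed_rootP; rewrite size_map_poly_id0 //.
  apply: contraNneq glc => sz; have := qc.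
  have qC := size1_polyC (eq_leq sz); rewrite qC map_polyC rootC => /eqP/fg.
  by rewrite lead_coefC /= => ->.
have p0' : map_poly g p0 != 0.
  by apply: contraNneq p00 => /(same_kernel_map_poly gf) ->.
have q0' : map_poly g q != 0.
  by rewrite -lead_coef_eq0 lead_coef_map_eq //.
have [q' [glc' q'c'2 _ q'P]] := root_reduce q0' q'c'.
have flc' : f (lead_coef q') != 0 by apply: contraNneq glc' => /fg ->.
have fwd p : root (map_poly f p) c -> root (map_poly g p) c'.
  case/qP=> k [s [r [pE /(same_kernel_map_poly fg) r0]]].
  have : root (map_poly g (lead_coef q ^+ k *: p)) c'.
    by rewrite pE rmorphD rmorphM /= r0 addr0 rootM q'c' orbT.
  by rewrite linearZ /= rmorphXn rootZ // expf_neq0.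
exists c' => p; split; first exact: fwd.
have bwd p1 : root (map_poly g p1) c' -> root (map_poly f q') c ->
    root (map_poly f p1) c.
  case/q'P=> k [s [r [pE /(same_kernel_map_poly gf) r0]]] q'c.
  have : root (map_poly f (lead_coef q' ^+ k *: p1)) c.
    by rewrite pE rmorphD rmorphM /= r0 addr0 rootM q'c orbT.
  by rewrite linearZ /= rmorphXn rootZ // expf_neq0.
suff q'c : root (map_poly f q') c by move=> /bwd; apply.
(* [q = s q'] up to kernel and constants, so [c] is a root of [q'] or [s]. *)
have [k [s [r [qE /(same_kernel_map_poly gf) r0]]]] := q'P _ q'c'.
have : root (map_poly f (lead_coef q' ^+ k *: q)) c.
  by rewrite linearZ /= rmorphXn rootZ ?expf_neq0.
have q_neq0 : map_poly f (lead_coef q' ^+ k *: q) != 0.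
  rewrite linearZ /= rmorphXn scaler_eq0 expf_eq0 (negPf flc') andbF /=.
  by rewrite -lead_coef_eq0 lead_coef_map_eq.
have szq : size (map_poly f (lead_coef q' ^+ k *: q)) = size q.
  by rewrite linearZ /= rmorphXn size_scale ?expf_neq0 // size_map_poly_id0.
move: q_neq0 szq; rewrite qE rmorphD rmorphM /= r0 addr0 mulf_eq0 negb_or.
case/andP=> s0 q'0; rewrite size_mul // (size_map_poly_id0 flc') => szq.
(* If [c] were a root of [s], minimality would make [s] at least as large as [q], although [q']
   takes up a positive part of the degree. *)
rewrite rootM => /orP[sc|//]; have := qmin _ s0 sc.
have : (1 < size q')%N.
  rewrite -(size_map_poly_id0 glc'); apply: root_size_gt1 q'c'2.
  by rewrite -lead_coef_eq0 lead_coef_map_eq.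
rewrite -szq; case: (size q') => [|[|m]] // _.
by rewrite !addnS /= ltnNge leq_addr.
Qed.

(** The elements of [s] are adjoined as variables without dividing out relations, so that [{poly A}]
    stays a countable domain. *)
Lemma same_kernel_extend (A : idomainType) (f g : {rmorphism A -> F})
    (s : seq F) :
  (countable [set: A])%classic -> same_kernel f g ->
  exists (B : idomainType) (f' g' : {rmorphism B -> F}) (i : {rmorphism A -> B}),
    [/\ (countable [set: B])%classic, same_kernel f' g', f' \o i =1 f,
       g' \o i =1 g & forall c, c \in s -> exists y, f' y = c].
Proof.
elim: s A f g => [|c s ih] A f g cA fg.
  by exists A, f, g, idfun.
have [c' c'P] := same_kernel_root c cA fg.
pose f1 : {rmorphism {poly A} -> F} := horner_eval c \o map_poly f.
pose g1 : {rmorphism {poly A} -> F} := horner_eval c' \o map_poly g.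
have fg1 : same_kernel f1 g1.
  by move=> p; have := c'P p; rewrite /root !(rwP eqP).
have [B [f' [g' [i [cB fg' f'i g'i sP]]]]] := ih _ f1 g1 (countable_poly cA) fg1.
exists B, f', g', (i \o polyC).
split=> //= [a|a|d].
- by rewrite [LHS]f'i /f1 /= /horner_eval map_polyC hornerC.
- by rewrite [LHS]g'i /g1 /= /horner_eval map_polyC hornerC.
- rewrite inE => /predU1P[->|/sP//]; exists (i 'X).
  by rewrite [LHS]f'i /f1 /= /horner_eval map_polyX hornerX.
Qed.

(* With [B] playing the role of a polynomial ring, the families [f' \o y = z]
   and [g' \o y] satisfy the same polynomial relations over [f] and [g]. *)
Lemma same_kernel_lift (A : idomainType) (f g : {rmorphism A -> F})
    (J : finType) (z : J -> F) :
  (countable [set: A])%classic -> same_kernel f g ->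
  exists (B : idomainType) (f' g' : {rmorphism B -> F}) (i : {rmorphism A -> B})
    (y : J -> B),
    [/\ (countable [set: B])%classic, same_kernel f' g', f' \o i =1 f,
       g' \o i =1 g & f' \o y =1 z].
Proof.
move=> cA fg; have [B [f' [g' [i [cB fg' f'i g'i sP]]]]] :=
  same_kernel_extend [seq z j | j : J] cA fg.
have /choice[y yP] j : exists y, f' y = z j by apply: sP; exact: codom_f.
by exists B, f', g', i, y; split.
Qed.
End Transfer.

(** * Algebraic independence and Jacobians *)

Lemma msize_prod_exp n m (y : 'I_m -> {mpoly rat[n]}) (a : 'I_m -> nat) D K :
  (forall j, (msize (y j) <= D.+1)%N) -> (forall j, (a j <= K)%N) ->
  (msize (\prod_j y j ^+ a j) <= (m * (K * D)).+1)%N.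
Proof.
move=> yD aK.
have msM (p q : {mpoly rat[n]}) b c : (msize p <= b.+1)%N ->
    (msize q <= c.+1)%N -> (msize (p * q) <= (b + c).+1)%N.
  have [->|p0] := eqVneq p 0; first by rewrite mul0r msize0.
  have [->|q0] := eqVneq q 0; first by rewrite mulr0 msize0.
  move=> pb qc; rewrite msizeM //; have := leq_add pb qc.
  by case: (_ + _)%N => // k; rewrite addSn addnS.
have msX j : (msize (y j ^+ a j) <= (K * D).+1)%N.
  apply: leq_trans (_ : (a j * D).+1 <= _)%N; last by rewrite ltnS leq_mul2r aK orbT.
  elim: (a j) => [|b ih]; first by rewrite expr0 msize1.
  by rewrite exprS mulSn; apply: msM.
rewrite -[m in X in (_ <= X)%N]card_ord -sum_nat_const.
elim/big_ind2: _ => [|p b q c|//]; first by rewrite msize1.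
exact: msM.
Qed.

(* Counting: the monomials in [y] with exponents at most [K] outnumber, for large
   [K], the monomials in [n] variables of degree less than [B]. *)
Lemma mpoly_dependent n m (y : 'I_m -> {mpoly rat[n]}) : (n < m)%N ->
  exists P : {mpoly rat[m]}, P != 0 /\ mmap (@mpolyC n rat) y P = 0.
Proof.
move=> nm; pose D := (\max_j msize (y j))%N.
have yD j : (msize (y j) <= D.+1)%N by rewrite ltnW // ltnS leq_bigmax.
(* With this choice [B <= (m * D + 1) * K], hence [B ^ n <= K ^ n.+1 < K.+1 ^ m]. *)
pose K := ((m * D + 1) ^ n)%N; pose B := (m * (K * D)).+1.
have K_gt0 : (0 < K)%N by rewrite expn_gt0 addn1.
pose S := {ffun 'I_m -> 'I_K.+1}; pose T := 'X_{1..n < B}.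
pose Y (a : S) := \prod_j y j ^+ a j.
have YB a : (msize (Y a) <= B)%N by apply: msize_prod_exp => // j; rewrite -ltnS.
have TS : (#|{: T}| < #|{: S}|)%N.
  rewrite card_ffun !card_ord; apply: leq_ltn_trans (_ : B ^ n < _)%N.
    have <- : #|{ffun 'I_n -> 'I_B}| = (B ^ n)%N by rewrite card_ffun !card_ord.
    have tB (t : T) i : (t i < B)%N.
      by apply: leq_ltn_trans (bmdeg t); rewrite mdegE (bigD1 i) //= leq_addr.
    pose f (t : T) := [ffun i => Ordinal (tB t i)].
    apply: (leq_card f) => s t /ffunP st; apply/val_inj/mnmP => i.
    by have := st i; rewrite !ffunE => -[].
  apply: leq_ltn_trans (_ : ((m * D + 1) * K) ^ n < _)%N.
    case: (posnP n) => [->|n0]; first by rewrite !expn0.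
    rewrite leq_exp2r // /B mulnDl mul1n -addn1 mulnAC -mulnA leq_add2l //.
  rewrite expnMn -/K -expnS; apply: leq_trans (_ : K.+1 ^ n.+1 <= _)%N.
    by rewrite ltn_exp2r.
  by rewrite leq_exp2l.
pose M : 'M[rat]_(#|{: S}|, #|{: T}|) :=
  \matrix_(i, j) (Y (enum_val i))@_(enum_val j : T).
have : kermx M != 0.
  rewrite -mxrank_eq0 mxrank_ker subn_eq0 -ltnNge.
  exact: leq_ltn_trans (rank_leq_col _) TS.
case/rowV0Pn=> v; rewrite sub_kermx => /eqP vM v0.
pose mn (a : S) : 'X_{1..m} := [multinom (a j : nat) | j < m].
have mn_inj : injective mn.
  move=> a b /mnmP ab; apply/ffunP => j; apply/val_inj.
  by have := ab j; rewrite !mnmE.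
pose P : {mpoly rat[m]} := \sum_(a : S) v 0 (enum_rank a) *: 'X_[mn a].
have PE a : P@_(mn a) = v 0 (enum_rank a).
  rewrite raddf_sum (bigD1 a) //= mcoeffZ mcoeffX eqxx mulr1 big1 ?addr0 //.
  move=> b ba; rewrite mcoeffZ mcoeffX.
  by rewrite (inj_eq mn_inj) (negPf ba) mulr0.
exists P; split.
  apply: contraNneq v0 => P0; apply/eqP/rowP => i; rewrite mxE.
  by have := PE (enum_val i); rewrite P0 mcoeff0 enum_valK => <-.
rewrite rmorph_sum /=; under eq_bigr => a _.
  rewrite mmapZ mmapX /mmap1; under eq_bigr => j _ do rewrite mnmE.
  rewrite -/(Y a); over.
apply/mpolyP => t; rewrite mcoeff0 raddf_sum /=.
under eq_bigr => a _ do rewrite mul_mpolyC mcoeffZ.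
have [tB|tB] := ltnP (mdeg t) B; last first.
  rewrite big1 // => a _; rewrite memN_msupp_eq0 ?mulr0 //.
  by apply: msize_mdeg_ge; exact: leq_trans (YB a) tB.
have /rowP/(_ (enum_rank (BMultinom tB))) := vM; rewrite !mxE => vt.
rewrite -[RHS]vt (reindex (enum_val : 'I_#|{: S}| -> S)) /=; last first.
  by apply: onW_bij; exact: enum_val_bij.
by apply: eq_bigr => i _; rewrite !mxE enum_valK enum_rankK.
Qed.

(** Only agreement is propagated through sums and products, so the principle serves derivations as
    well as ring morphisms. *)
Lemma mpoly_eq_on_vars n (A : comNzRingType) (S : zmodType)
    (d1 d2 : {mpoly A[n]} -> S) :
  (forall c p, d1 p = d2 p -> d1 (c *: p) = d2 (c *: p)) ->
  (forall p q, d1 p = d2 p -> d1 q = d2 q -> d1 (p + q) = d2 (p + q)) ->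
  (forall p q, d1 p = d2 p -> d1 q = d2 q -> d1 (p * q) = d2 (p * q)) ->
  d1 1 = d2 1 -> (forall i, d1 'X_i = d2 'X_i) -> d1 =1 d2.
Proof.
move=> dZ dD dM d_1 dX p; elim/mpolyind: p => [|c m p _ _ ih].
  by rewrite -(scale0r 1); apply: dZ.
apply: dD => //; apply: dZ; rewrite mpolyXE_id.
elim/big_ind: _ => // i _; elim: (m i) => [|k ihk]; first by rewrite expr0.
by rewrite exprS; apply: dM.
Qed.

Lemma mmapM n (A : nzRingType) (S : comNzRingType) (f : {rmorphism A -> S})
    (x : 'I_n -> S) : {morph mmap f x : p q / p * q}.
Proof. exact: rmorphM. Qed.

Lemma mmap_1 n (A : nzRingType) (S : comNzRingType) (f : {rmorphism A -> S})
    (x : 'I_n -> S) : mmap f x 1 = 1.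
Proof. exact: rmorph1. Qed.

Lemma mderivXU n (A : comNzRingType) (i j : 'I_n) :
  ('X_j : {mpoly A[n]})^`M(i) = (i == j)%:R.
Proof.
rewrite mderivX mnm1E eq_sym; case: eqP => [->|_]; last by rewrite scale0r.
suff -> : (U_(j) - U_(j) = 0 :> 'X_{1..n})%MM by rewrite scale1r mpolyX0.
by apply/mnmP => k; rewrite mnmBE subnn mnmE.
Qed.

Section DirectionalDerivative.
Variables (n : nat) (A : comNzRingType) (S : comNzRingType).
Variables (e : {rmorphism {mpoly A[n]} -> S}) (h : 'I_n -> S).

Definition dderiv (z : {mpoly A[n]}) : S := \sum_i h i * e z^`M(i).

Lemma dderivD z w : dderiv (z + w) = dderiv z + dderiv w.
Proof.
rewrite /dderiv -big_split; apply: eq_bigr => i _ /=.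
by rewrite mderivD rmorphD mulrDr.
Qed.

Lemma dderivZ c z : dderiv (c *: z) = e c%:MP * dderiv z.
Proof.
rewrite /dderiv mulr_sumr; apply: eq_bigr => i _.
by rewrite mderivZ -mul_mpolyC rmorphM mulrCA.
Qed.

Lemma dderivM z w : dderiv (z * w) = dderiv z * e w + e z * dderiv w.
Proof.
rewrite /dderiv mulr_suml mulr_sumr -big_split; apply: eq_bigr => i _ /=.
by rewrite mderivM rmorphD !rmorphM mulrDr mulrA mulrCA.
Qed.

Lemma dderivC c : dderiv c%:MP = 0.
Proof. by rewrite /dderiv big1 // => i _; rewrite mderivC rmorph0 mulr0. Qed.

Lemma dderivX i : dderiv 'X_i = h i.
Proof.
rewrite /dderiv (bigD1 i) //= mderivXU eqxx rmorph1 mulr1 big1 ?addr0 // => j ji.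
by rewrite mderivXU (negPf ji) rmorph0 mulr0.
Qed.
End DirectionalDerivative.

(** The chain rule; both sides are derivations along the same evaluation and agree on the
    variables. *)
Lemma dderiv_mmap n m (A S : comNzRingType) (e : {rmorphism {mpoly A[n]} -> S})
    (h : 'I_n -> S) (y : 'I_m -> {mpoly A[n]}) (P : {mpoly A[m]}) :
  dderiv e h (mmap (@mpolyC n A) y P) =
  dderiv (e \o mmap (@mpolyC n A) y) (fun j => dderiv e h (y j)) P.
Proof.
move: P; apply: mpoly_eq_on_vars => [c p E|p q E1 E2|p q E1 E2||j].
- by rewrite mmapZ mul_mpolyC !dderivZ E /= mmapC.
- by rewrite mmapD !dderivD E1 E2.
- by rewrite mmapM !dderivM E1 E2.
- by rewrite mmap_1 -!mpolyC1 !dderivC.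
- by rewrite mmapX mmap1U dderivX.
Qed.

Definition mpoly_indep n m (y : 'I_m -> {mpoly rat[n]}) : Prop :=
  forall P : {mpoly rat[m]}, mmap (@mpolyC n rat) y P = 0 -> P = 0.

Definition generic_point (F : numFieldType) n (x : 'I_n -> F) : Prop :=
  forall p : {mpoly rat[n]}, mmap ratr x p = 0 -> p = 0.

Definition snoc (T : Type) m (y : 'I_m -> T) (t : T) (j : 'I_m.+1) : T :=
  oapp y t (unlift ord_max j).

Lemma snoc_max T m (y : 'I_m -> T) t : snoc y t ord_max = t.
Proof. by rewrite /snoc unlift_none. Qed.

Lemma snoc_widen T m (y : 'I_m -> T) t (j : 'I_m) :
  snoc y t (widen_ord (leqnSn m) j) = y j.
Proof.
have -> : widen_ord (leqnSn m) j = lift ord_max j.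
  by apply/val_inj; rewrite /= /bump leqNgt ltn_ord.
by rewrite /snoc liftK.
Qed.

Lemma mmap_snoc (A S : comNzRingType) (f : {rmorphism A -> S}) m
    (y : 'I_m -> S) t (P : {mpoly A[m.+1]}) :
  mmap f (snoc y t) P = (map_poly (mmap f y) (muni P)).[t].
Proof.
rewrite mmap_muni snoc_max; congr (map_poly (mmap _ _) _).[_].
by apply/funext => j; rewrite /= snoc_widen.
Qed.

Lemma msize_mderiv n (A : idomainType) (i : 'I_n) (P : {mpoly A[n]}) :
  P != 0 -> (msize P^`M(i) < msize P)%N.
Proof.
rewrite -msize_poly_eq0 -lt0n => P0.
rewrite -(prednK P0) ltnS msizeE; apply/bigmax_leqP_seq => m.
rewrite mcoeff_msupp mcoeff_deriv => mP _.
have /msize_mdeg_lt : (m + U_(i))%MM \in msupp P.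
  by rewrite mcoeff_msupp; apply: contraNneq mP => ->; rewrite mul0rn.
by rewrite mdegD mdeg1 addn1 => lt_m; rewrite -ltnS (prednK P0).
Qed.

(** In characteristic zero every monomial containing the last variable leaves a nonzero trace in the
    derivative. *)
Lemma muni_const n (A : numDomainType) (P : {mpoly A[n.+1]}) :
  P^`M(ord_max) = 0 -> exists Q, muni P = Q%:P.
Proof.
move=> dP.
exists (\sum_(m <- msupp P)
   P@_m *: 'X_[[multinom (m (widen_ord (leqnSn n) i)) | i < n]]).
rewrite muniE rmorph_sum big_seq [RHS]big_seq; apply: eq_bigr => m mP.
suff -> : m ord_max = 0%N by rewrite expr0 alg_polyC.
apply: contraTeq mP; rewrite -lt0n mcoeff_msupp negbK => m0.
have : (P^`M(ord_max))@_(m - U_(ord_max)) = 0 by rewrite dP mcoeff0.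
rewrite mcoeff_deriv submK; last first.
  by apply/mnm_lepP => i; rewrite mnm1E; case: eqP => // <-.
by rewrite -mulr_natr => /eqP; rewrite mulf_eq0 pnatr_eq0 orbF.
Qed.

Lemma mmap_mmap (A S : comNzRingType) (f : {rmorphism A -> S}) n m
    (s : 'I_n -> S) (q : 'I_m -> {mpoly A[n]}) (P : {mpoly A[m]}) :
  mmap f s (mmap (@mpolyC n A) q P) = mmap f (fun j => mmap f s (q j)) P.
Proof.
move: P; apply: mpoly_eq_on_vars => [c p E|p r E1 E2|p r E1 E2||j].
- by rewrite !mmapZ mmapM mmapC E.
- by rewrite !mmapD E1 E2.
- by rewrite !mmapM E1 E2.
- by rewrite !mmap_1.
- by rewrite !mmapX !mmap1U.
Qed.

Section Jacobian.
Variables (F : numFieldType) (n : nat) (x : 'I_n -> F).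
Hypothesis x_gen : generic_point x.
Local Notation D h z := (dderiv (mmap (ratr : rat -> F) x) h z).

(* Differentiate a relation [P] of minimal size between [y] and [z]: by
   minimality its partial derivative in the last variable is nonzero at [x]. *)
Lemma dderiv_dependent m (y : 'I_m -> {mpoly rat[n]}) (z : {mpoly rat[n]})
    (h : 'I_n -> F) :
  mpoly_indep y -> ~ mpoly_indep (snoc y z) ->
  (forall j, D h (y j) = 0) -> D h z = 0.
Proof.
move=> yi ynd hy; set y' := snoc y z.
have [k [P [P0 yP szP]] kmin] : exists2 k,
    exists P, [/\ P != 0, mmap (@mpolyC n rat) y' P = 0 & msize P = k]
  & forall P, P != 0 -> mmap (@mpolyC n rat) y' P = 0 -> (k <= msize P)%N.
  pose Q k := `[< exists P, [/\ P != 0, mmap (@mpolyC n rat) y' P = 0 &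
    msize P = k] >].
  have exQ : exists k, Q k.
    have [[P []]|nex] := pselect (exists P, P != 0 /\ mmap (@mpolyC n rat) y' P = 0).
      by exists (msize P); apply/asboolP; exists P.
    case: ynd => P yP; apply: contrapT => P0; apply: nex; exists P.
    by split=> //; apply/eqP.
  case: (ex_minnP exQ) => k /asboolP Qk kmin; exists k => // P P0 yP.
  by apply: kmin; apply/asboolP; exists P.
have : D h (mmap (@mpolyC n rat) y' P) = 0 by rewrite yP -mpolyC0 dderivC.
rewrite dderiv_mmap /dderiv big_ord_recr /= -/y' big1 => [|j _]; last first.
  by rewrite /= /y' snoc_widen; have := hy j; rewrite /dderiv => ->; rewrite mul0r.
rewrite add0r /y' snoc_max -/y' => /eqP; rewrite mulf_eq0 => /orP[/eqP//|/eqP].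
move/x_gen => yP'; have P'0 : P^`M(ord_max) = 0.
  apply: contraTeq isT => /[dup] dP0 /kmin/(_ yP').
  by rewrite leqNgt -szP msize_mderiv.
have [Q PQ] := muni_const P'0; case/eqP: P0; apply: muni_inj.
rewrite PQ muni0; move: yP; rewrite mmap_snoc PQ map_polyC hornerC /=.
by move/yi => ->.
Qed.

(** If no variable can be added to the family, every ['X_i] depends on it, so a direction killing
    the family is zero and the Jacobian is square and invertible. The general case adds variables
    first. *)
Lemma dderiv_onto m (y : 'I_m -> {mpoly rat[n]}) (c : 'I_m -> F) :
  mpoly_indep y -> exists h, forall j, D h (y j) = c j.
Proof.
have mn l (w : 'I_l -> {mpoly rat[n]}) : mpoly_indep w -> (l <= n)%N.
  move=> wi; rewrite leqNgt; apply/negP => /(mpoly_dependent w)[P [P0 /wi]].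
  exact/eqP.
have fin l (w : 'I_l -> {mpoly rat[n]}) (b : 'I_l -> F) : mpoly_indep w ->
    ~ (exists i, mpoly_indep (snoc w 'X_i)) -> exists h, forall j, D h (w j) = b j.
  move=> wi nex.
  pose J : 'M[F]_(n, l) := \matrix_(i, j) mmap (ratr : rat -> F) x (w j)^`M(i).
  have JE (h : 'rV[F]_n) j : (h *m J) 0 j = D (h 0) (w j).
    by rewrite mxE; apply: eq_bigr => i _; rewrite mxE.
  have J_free : row_free J.
    rewrite -kermx_eq0; apply/rowV0P => h; rewrite sub_kermx => /eqP hJ.
    apply/rowP => i; rewrite [RHS]mxE -(dderivX (mmap (ratr : rat -> F) x) (h 0)).
    apply: (dderiv_dependent wi) => [wXi|j]; first by apply: nex; exists i.
    by rewrite -JE hJ mxE.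
  have /row_fullP[B BJ] : row_full J.
    rewrite /row_full eqn_leq rank_leq_col /=; move/eqP: J_free => ->; exact: mn wi.
  exists (((\row_j b j) *m B) 0) => j.
  by rewrite -JE -(mulmxA _ B J) BJ mulmx1 mxE.
elim: {m}(n - m)%N {-2}m (leqnn (n - m)) y c => [|k ih] m nk y c yi.
  apply: fin => // -[i /mn]; rewrite ltnNge => /negP; apply.
  by rewrite -subn_eq0 -leqn0.
have [[i yXi]|nex] := pselect (exists i, mpoly_indep (snoc y 'X_i)); last exact: fin.
have [||h hP] := ih m.+1 _ (snoc y 'X_i) (snoc c 0) => //.
  by rewrite subnS -ltnS prednK // subn_gt0 (mn _ _ yXi).
by exists h => j; have := hP (widen_ord (leqnSn m) j); rewrite !snoc_widen.
Qed.

(* [z] is algebraic over the [q j], and the lowest nonzero coefficient of its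
   equation is, up to powers of [z], a multiple of [z] that is a nonzero
   polynomial in the [q j]. *)
Lemma nonzero_at_indep (K : numFieldType) (s : 'I_n -> K) m
    (q : 'I_m -> {mpoly rat[n]}) (z : {mpoly rat[n]}) :
  (forall h, (forall j, D h (q j) = 0) -> D h z = 0) ->
  generic_point (fun j => mmap ratr s (q j)) ->
  z != 0 -> mmap ratr s z != 0.
Proof.
move=> dz gq z0.
have qi : mpoly_indep q by move=> P qP; apply: gq; rewrite -mmap_mmap qP mmap0.
have [P P0 qzP] : exists2 P, P != 0 & mmap (@mpolyC n rat) (snoc q z) P = 0.
  apply: contrapT => nex; have qzi : mpoly_indep (snoc q z).
    move=> P qzP; apply/eqP; apply: contrapT => P0; apply: nex.
    by exists P => //; apply/negP.
  (* Independence would give a direction that fixes all [q j] to first order but moves [z]. *)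
  have [h hP] := dderiv_onto (snoc (fun=> 0) 1) qzi.
  have := hP ord_max; rewrite !snoc_max dz => [/eqP|j].
    by rewrite eq_sym oner_eq0.
  by have := hP (widen_ord (leqnSn m) j); rewrite !snoc_widen.
rewrite mmap_snoc in qzP; set p := map_poly _ _ in qzP.
have pE i : p`_i = mmap (@mpolyC n rat) q (muni P)`_i by rewrite coef_map.
have [j pj jmin] : exists2 j, p`_j != 0 & forall i, (i < j)%N -> p`_i = 0.
  have exj : exists j, p`_j != 0.
    apply: contrapT => nex; case/eqP: P0; apply: muni_inj; rewrite muni0.
    apply/polyP => i; rewrite coef0; apply: qi; rewrite -pE.
    by apply/eqP; apply: contrapT => /negP pi; apply: nex; exists i.
  case: (ex_minnP exj) => j pj jmin; exists j => // i.
  by apply: contraTeq => /jmin; rewrite -leqNgt.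
have pX : p = drop_poly j p * 'X^j.
  rewrite -[LHS](poly_take_drop j) [take_poly j p](_ : _ = 0) ?add0r //.
  apply/polyP => i; rewrite coef_take_poly coef0.
  by case: ltnP => [/jmin ->|].
have : (drop_poly j p).[z] = 0.
  have /eqP := qzP; rewrite {1}pX hornerM hornerXn mulf_eq0 expf_eq0 (negPf z0).
  by rewrite andbF orbF => /eqP.
move=> /(congr1 (mmap (ratr : rat -> K) s)); rewrite mmap0 -horner_map /=.
move=> root_z; apply: contraNneq pj => zs0; move: root_z.
rewrite zs0 horner_coef0 coef_map coef_drop_poly /= pE mmap_mmap.
by move/gq => ->; rewrite mmap0.
Qed.
End Jacobian.

(** * Flexes of rigid graphs at generic real placements *)

Section Newton.
Variable R : realType.

Lemma eq0_geometric (a c : R) : (forall k, `|a| <= c / 2 ^+ k) -> a = 0.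
Proof.
move=> ac; apply/eqP; rewrite -normr_eq0 eq_le normr_ge0 andbT leNgt.
apply/negP => a0; have c0 : 0 <= c by have := ac 0; rewrite expr0 divr1; apply: le_trans.
pose k := Num.bound (c / `|a|); have ck := archi_boundP (divr_ge0 c0 (ltW a0)).
have := ac k; rewrite leNgt => /negP; apply.
rewrite ltr_pdivrMr ?exprn_gt0 // mulrC -ltr_pdivrMr // (lt_le_trans ck) //.
by rewrite -natrX ler_nat ltnW // ltn_expl.
Qed.

(** The intervals about [u k] of radius [2 * c / 2 ^+ k] are nested; the supremum of their left ends
    lies in all of them. *)
Lemma geometric_cauchy (u : nat -> R) (c : R) :
  (forall k, `|u k.+1 - u k| <= c / 2 ^+ k) ->
  exists x, forall k, `|u k - x| <= 2 * c / 2 ^+ k.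
Proof.
move=> uc; pose e k := 2 * c / 2 ^+ k : R.
have eS k : e k.+1 = c / 2 ^+ k.
  by rewrite /e exprS invfM mulrACA mulrV ?mul1r // unitfE pnatr_eq0.
have e2 k : e k = e k.+1 + e k.+1.
  rewrite eS /e; ring.
have c0 : 0 <= c by have := uc 0; rewrite expr0 divr1; apply: le_trans.
have e0 k : 0 <= e k by rewrite divr_ge0 ?exprn_ge0 ?mulr_ge0.
have up n m : (n <= m)%N -> u n - e n <= u m - e m.
  elim: m => [|m ih]; first by rewrite leqn0 => /eqP ->.
  rewrite leq_eqVlt => /predU1P[-> //|/ih h]; apply: le_trans h _.
  have := uc m; rewrite -eS ler_norml (e2 m) => /andP[]; lra.
have dn n m : (n <= m)%N -> u m + e m <= u n + e n.
  elim: m => [|m ih]; first by rewrite leqn0 => /eqP ->.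
  rewrite leq_eqVlt => /predU1P[-> //|/ih h]; apply: le_trans h.
  have := uc m; rewrite -eS ler_norml (e2 m) => /andP[]; lra.
have cross n m : u n - e n <= u m + e m.
  apply: le_trans (up _ (maxn n m) (leq_maxl _ _)) _.
  apply: le_trans (dn m (maxn n m) (leq_maxr _ _)).
  by have := e0 (maxn n m); lra.
pose A := range (fun n => u n - e n).
have supA : has_sup A.
  by split; [exists (u 0%N - e 0%N), 0%N | exists (u 0%N + e 0%N) => _ [n _ <-]].
exists (sup A) => k; rewrite -/(e k) ler_norml.
have : u k - e k <= sup A by apply: ub_le_sup supA.2 _ _; exists k.
have : sup A <= u k + e k.
  by apply: ge_sup; [case: supA | move=> _ [n _ <-]].
by move=> *; apply/andP; split; lra.
Qed.

(** Iteration of [z -> eta - q z], a contraction near the origin since the Lipschitz constant of [q]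
    is proportional to the radius. *)
Lemma newton_quadratic m (q : 'I_m -> ('I_m -> R) -> R) (C eps : R) :
  0 <= C -> 0 < eps -> (forall j, q j (fun=> 0) = 0) ->
  (forall j z z' r s, (forall i, `|z i| <= r) -> (forall i, `|z' i| <= r) ->
     (forall i, `|z i - z' i| <= s) -> `|q j z - q j z'| <= C * r * s) ->
  exists2 del, 0 < del & forall eta, (forall j, `|eta j| <= del) ->
    exists2 z, (forall i, `|z i| <= eps) & forall j, z j + q j z = eta j.
Proof.
(* [2 * r <= eps] keeps the solution in range; [C * (2 * r) <= 1 / 2] gives contraction by a factor
   two on the ball of radius [2 * r]. *)
move=> C0 eps0 q0 qL; pose r := Num.min (eps / 2) (1 / (4 * C + 1)).
have D0 : 0 < 4 * C + 1 by lra.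
have r0 : 0 < r by rewrite lt_min !divr_gt0.
have r_eps : 2 * r <= eps.
  by rewrite mulrC -ler_pdivlMr // ge_min lexx.
have rC : C * (2 * r) <= 1 / 2.
  have : r <= 1 / (4 * C + 1) by rewrite ge_min lexx orbT.
  rewrite ler_pdivlMr // => h; have : 0 <= r * C by rewrite mulr_ge0 // ltW.
  nra.
exists (r / 2) => [|eta etaP]; first by rewrite divr_gt0.
pose z := fix z k := if k is k'.+1 then fun j => eta j - q j (z k') else fun=> 0 : R.
have zr k j : `|z k j| <= r.
  elim: k j => [|k ih] j /=; first by rewrite normr0 ltW.
  have := qL j (z k) (fun=> 0) (2 * r) r; rewrite q0 subr0 => qk.
  have {}qk : `|q j (z k)| <= C * (2 * r) * r.
    apply: qk => i; rewrite ?normr0 ?subr0; have := ih i; have := ltW r0; lra.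
  apply: le_trans (ler_normB _ _) _; have := etaP j; nra.
have z2r k j : `|z k j| <= 2 * r by apply: le_trans (zr k j) _; lra.
have zC k j : `|z k.+1 j - z k j| <= r / 2 ^+ k.
  elim: k j => [|k ih] j.
    by rewrite expr0 divr1 [z 0%N j]/= subr0.
  have := qL j (z k) (z k.+1) (2 * r) (r / 2 ^+ k) (z2r _) (z2r _) => qk.
  have {}qk : `|q j (z k) - q j (z k.+1)| <= C * (2 * r) * (r / 2 ^+ k).
    by apply: qk => i; rewrite distrC.
  rewrite [_ - _](_ : _ = q j (z k) - q j (z k.+1)); last by rewrite /=; ring.
  apply: le_trans qk _.
  have -> : r / 2 ^+ k.+1 = r / 2 ^+ k * 2^-1 by rewrite exprSr invfM mulrA.
  have : 0 <= r / 2 ^+ k by rewrite divr_ge0 ?exprn_ge0 ?ltW.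
  nra.
have /choice[x xP] j : exists x, forall k, `|z k j - x| <= 2 * r / 2 ^+ k.
  exact: geometric_cauchy.
have x2r j : `|x j| <= 2 * r.
  by have := xP j 0%N; rewrite [z 0%N j]/= sub0r normrN expr0 divr1.
exists x => [j|j]; first exact: le_trans (x2r j) r_eps.
apply/eqP; rewrite -subr_eq0; apply/eqP; apply: (@eq0_geometric _ (2 * r)) => k.
have e : x j + q j x - eta j = (x j - z k.+1 j) + (q j x - q j (z k)).
  by rewrite /=; ring.
have h1 := xP j k.+1; rewrite distrC exprS invfM mulrA in h1.
have h2 := qL j x (z k) (2 * r) (2 * r / 2 ^+ k) x2r (z2r _).
have {}h2 : `|q j x - q j (z k)| <= C * (2 * r) * (2 * r / 2 ^+ k).
  by apply: h2 => i; rewrite distrC.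
rewrite e; apply: le_trans (ler_normD _ _) _; apply: le_trans (lerD h1 h2) _.
have : 0 <= r / 2 ^+ k by rewrite divr_ge0 ?exprn_ge0 ?ltW.
have -> : 2 * r / 2 ^+ k = 2 * (r / 2 ^+ k) by rewrite mulrA.
have -> : 2 * r * 2^-1 * (2 ^+ k)^-1 = r / 2 ^+ k.
  by congr (_ / _); rewrite mulrAC mulfV ?mul1r // pnatr_eq0.
nra.
Qed.
End Newton.

Definition dotr (K : fieldType) d (a b : 'rV[K]_d) : K := \sum_i a 0 i * b 0 i.

Section LengthPolynomials.
Variables (W : finType) (d n : nat) (idx : W -> 'I_d -> 'I_n).

Definition len_poly (u v : W) : {mpoly rat[n]} :=
  \sum_i ('X_(idx u i) - 'X_(idx v i)) ^+ 2.

Definition placement (K : fieldType) (x : 'I_n -> K) (u : W) : 'rV[K]_d :=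
  \row_i x (idx u i).

Lemma len_polyE (K : numFieldType) (x : 'I_n -> K) u v :
  mmap ratr x (len_poly u v) = sqnorm (placement x u - placement x v).
Proof.
rewrite rmorph_sum; apply: eq_bigr => i _ /=.
by rewrite expr2 mmapM mmapB !mmapX !mmap1U !mxE expr2.
Qed.

Lemma dderiv_len_poly (K : numFieldType) (x h : 'I_n -> K) u v :
  dderiv (mmap ratr x) h (len_poly u v) =
  2 * dotr (placement x u - placement x v) (placement h u - placement h v).
Proof.
have dderiv_sum (z : 'I_d -> {mpoly rat[n]}) :
    dderiv (mmap ratr x) h (\sum_i z i) = \sum_i dderiv (mmap ratr x) h (z i).
  apply: (big_morph (dderiv _ h)); first exact: dderivD.
  by rewrite -mpolyC0 dderivC.
rewrite dderiv_sum mulr_sumr; apply: eq_bigr => i _.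
rewrite expr2 dderivM dderivD -[- 'X__]scaleN1r dderivZ !dderivX !mxE /=.
rewrite mmapD mmapZ !mmapX !mmap1U mmapC rmorphN1; ring.
Qed.
End LengthPolynomials.

(** * Continuity at the origin and isolation of roots *)

Section SmallBall.
Variables (R : realType) (m : nat).
Implicit Types f g : ('I_m -> R) -> R.

Definition near0 (Q : ('I_m -> R) -> Prop) : Prop :=
  exists2 t : R, 0 < t & forall z, (forall i, `|z i| <= t) -> Q z.

Lemma near0I Q1 Q2 : near0 Q1 -> near0 Q2 -> near0 (fun z => Q1 z /\ Q2 z).
Proof.
move=> [t t0 tQ] [s s0 sQ]; exists (Num.min t s); first by rewrite lt_min t0.
move=> z zts; split; [apply: tQ | apply: sQ] => i;
  by apply: le_trans (zts i) _; rewrite ge_min lexx ?orbT.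
Qed.

Lemma near0_sub (Q1 Q2 : _ -> Prop) :
  (forall z, Q1 z -> Q2 z) -> near0 Q1 -> near0 Q2.
Proof. by move=> sQ [t t0 tQ]; exists t => // z /tQ/sQ. Qed.

Lemma near0_all (I : finType) (Q : I -> ('I_m -> R) -> Prop) :
  (forall i, near0 (Q i)) -> near0 (fun z => forall i, Q i z).
Proof.
move=> Qi; suff : near0 (fun z => forall i, i \in enum I -> Q i z).
  by apply: near0_sub => z h i; apply: h; rewrite mem_enum.
elim: (enum I) => [|i s ih]; first by exists 1.
apply: near0_sub (near0I (Qi i) ih) => z [h1 h2] j.
by rewrite inE => /predU1P[->|/h2].
Qed.

Definition cont0 f : Prop :=
  forall e, 0 < e -> near0 (fun z => `|f z - f (fun=> 0)| < e).

Lemma cont0_cst c : cont0 (fun=> c).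
Proof. by move=> e e0; exists 1 => // z _; rewrite subrr normr0. Qed.

Lemma cont0_proj i : cont0 (fun z => z i).
Proof.
move=> e e0; exists (e / 2) => [|z /(_ i) zi]; first by rewrite divr_gt0.
by rewrite subr0 (le_lt_trans zi) // ltr_pdivrMr // ltr_pMr // ltrDl.
Qed.

Lemma cont0D f g : cont0 f -> cont0 g -> cont0 (fun z => f z + g z).
Proof.
move=> cf cg e e0; have e2 : 0 < e / 2 by rewrite divr_gt0.
apply: near0_sub (near0I (cf _ e2) (cg _ e2)) => z [h1 h2].
rewrite opprD addrACA (le_lt_trans (ler_normD _ _)) // [ltRHS]splitr.
exact: ltrD.
Qed.

Lemma cont0M f g : cont0 f -> cont0 g -> cont0 (fun z => f z * g z).
Proof.
move=> cf cg e e0; set f0 := f (fun=> 0); set g0 := g (fun=> 0).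
pose a := e / (2 * (`|g0| + 1)); pose b := e / (2 * (`|f0| + 1)).
have G0 : 0 < `|g0| + 1 by rewrite ltr_wpDl.
have F0 : 0 < `|f0| + 1 by rewrite ltr_wpDl.
have a0 : 0 < a by rewrite divr_gt0 ?mulr_gt0.
have b0 : 0 < b by rewrite divr_gt0 ?mulr_gt0.
apply: near0_sub (near0I (near0I (cf _ a0) (cg _ b0)) (cg _ ltr01)).
move=> z [[h1 h2] h3]; rewrite -/f0 -/g0 in h1 h2 h3 *.
have -> : f z * g z - f0 * g0 = (f z - f0) * g z + f0 * (g z - g0) by ring.
have h4 : `|g z| <= `|g0| + 1.
  have -> : g z = g0 + (g z - g0) by ring.
  by rewrite (le_trans (ler_normD _ _)) // lerD2l ltW.
rewrite (le_lt_trans (ler_normD _ _)) // !normrM.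
have e1 : `|f z - f0| * `|g z| <= e / 2.
  apply: le_trans (_ : a * (`|g0| + 1) <= _); first by rewrite ler_pM // ltW.
  by rewrite /a invfM mulrA mulfVK // gt_eqF.
have e2 : `|f0| * `|g z - g0| < e / 2.
  apply: le_lt_trans (_ : `|f0| * b < _); first by rewrite ler_wpM2l // ltW.
  have -> : e / 2 = b * (`|f0| + 1) by rewrite /b invfM mulrA mulfVK // gt_eqF.
  by rewrite mulrDr mulr1 mulrC ltrDl.
by rewrite [ltRHS]splitr ler_ltD.
Qed.

Lemma cont0_sum (I : finType) (f : I -> ('I_m -> R) -> R) :
  (forall i, cont0 (f i)) -> cont0 (fun z => \sum_i f i z).
Proof.
move=> cf; elim: (index_enum I) => [|i s ih].
  rewrite (_ : (fun z => _) = fun=> 0); first exact: cont0_cst.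
  by apply/funext => z; rewrite big_nil.
rewrite (_ : (fun z => _) = fun z => f i z + \sum_(j <- s) f j z).
  exact: cont0D.
by apply/funext => z; rewrite big_cons.
Qed.
End SmallBall.

(** Roots other than [a] are divided out one at a time; [g] is the least of 1 and their distances to
    [a]. *)
Lemma root_isolated (R : realFieldType) (p : {poly R}) (a : R) : p != 0 ->
  exists2 g, 0 < g & forall r, root p r -> `|r - a| < g -> r = a.
Proof.
elim: {p}(size p) {-2}p (leqnn (size p)) => [|k ih] p sz p0.
  by move: sz p0; rewrite leqn0 size_poly_eq0 => ->.
have [[r [pr ra]]|nr] := pselect (exists r, root p r /\ r != a); last first.
  exists 1 => // r pr _; apply/eqP/negPn/negP => ra; apply: nr; by exists r.
have /factor_theorem[q pq] := pr.
have q0 : q != 0 by apply: contraNneq p0 => q0; rewrite pq q0 mul0r.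
have [|g g0 gP] := ih q _ q0.
  by move: sz; rewrite pq size_mul ?polyXsubC_eq0 // size_XsubC addn2.
exists (Num.min g `|r - a|) => [|s]; first by rewrite lt_min g0 normr_gt0 subr_eq0.
rewrite pq rootM root_XsubC lt_min => /orP[/gP h /andP[/h]//|/eqP ->].
by rewrite ltxx andbF.
Qed.

(** * From local rigidity to infinitesimal rigidity *)

Section InfinitesimalRigidity.
Variables (R : realType) (d : nat) (W : finType) (G : graph W).
Local Notation n := #|{: W * 'I_d}|.
Local Notation idx u i := (enum_rank (u, i) : 'I_n).
Local Notation L p := (len_poly (fun u i => idx u i) p.1 p.2).

Lemma mpoly_indep0 k (y : 'I_0 -> {mpoly rat[k]}) : mpoly_indep y.
Proof.
move=> P; rewrite [P]mpoly0_const.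
by rewrite mmapC => /eqP; rewrite mpolyC_eq0 => /eqP ->; rewrite mpolyC0.
Qed.

(** A transcendence basis of the squared edge lengths: an independent family of maximal size,
    bounded through [mpoly_dependent]. *)
Lemma exists_edge_basis :
  exists m (y : 'I_m -> W * W),
    [/\ forall j, [set (y j).1; (y j).2]%SET \in edges G,
       mpoly_indep (fun j => L (y j)) &
       forall p, [set p.1; p.2]%SET \in edges G ->
         ~ mpoly_indep (snoc (fun j => L (y j)) (L p))].
Proof.
pose Q m := `[< exists y : 'I_m -> W * W,
  (forall j, [set (y j).1; (y j).2]%SET \in edges G) /\
  mpoly_indep (fun j => L (y j)) >].
have exQ : exists m, Q m.
  exists 0%N; apply/asboolP; exists (fun j : 'I_0 => False_rect _ (notF (ltn_ord j))).
  by split=> [[]//|]; exact: mpoly_indep0.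
have Qn m : Q m -> (m <= n)%N.
  move/asboolP=> [y [_ yi]]; rewrite leqNgt; apply/negP.
  by move=> /(mpoly_dependent (fun j => L (y j)))[P [P0 /yi]]; exact/eqP.
case: (ex_maxnP exQ Qn) => m /asboolP[y [yE yi]] mmax.
exists m, y; split=> // p pE ypi.
suff /mmax : Q m.+1 by rewrite ltnn.
apply/asboolP; exists (snoc y p); split=> [j|].
  by rewrite /snoc; case: unliftP => [i|] _ /=.
rewrite [X in mpoly_indep X](_ : _ = snoc (fun j => L (y j)) (L p)) //.
by apply/funext => j; rewrite /snoc; case: unliftP.
Qed.

Definition coords (K : fieldType) (rho : W -> 'rV[K]_d) (k : 'I_n) : K :=
  rho (enum_val k).1 0 (enum_val k).2.

Lemma coordsK (K : fieldType) (rho : W -> 'rV[K]_d) :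
  placement (fun u i => idx u i) (coords rho) = rho.
Proof. by apply/funext => u; apply/rowP => i; rewrite mxE /coords enum_rankK. Qed.

(* If the infinitesimal flex [h] changed the length of [ab], then [ab] and a
   basis [y] of the edges would have independent differentials, and Newton's
   method would give nearby placements with the lengths of [y] fixed and that
   of [ab] changed.  The lengths of the other edges, being roots of fixed
   nonzero polynomials over those of [y], would not change either. *)
Lemma rigid_infinitesimal (rho h : W -> 'rV[R]_d) :
  rigid R d G -> generic_realization rho ->
  (forall u v, [set u; v]%SET \in edges G ->
     dotr (rho u - rho v) (h u - h v) = 0) ->
  forall a b, dotr (rho a - rho b) (h a - h b) = 0.
Proof.
move=> rigG rho_gen hE a b; have [eps eps0 epsP] := rigG rho rho_gen.
pose x := coords rho; have x_gen : generic_point x by exact: rho_gen.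
have [m [y [yE yi ymax]]] := exists_edge_basis.
apply/eqP/negPn/negP => hab.
pose y' := snoc y (a, b).
have y'L : (fun j => L (y' j)) = snoc (fun j => L (y j)) (L (a, b)).
  by apply/funext => j; rewrite /y' /snoc; case: unliftP.
have y'i : mpoly_indep (fun j => L (y' j)).
  apply: contrapT; rewrite y'L => nd; case/negP: hab.
  have /= := dderiv_dependent (h := coords h) x_gen yi nd.
  rewrite dderiv_len_poly !coordsK => /(_ _)/eqP.
  rewrite mulf_eq0 pnatr_eq0 /=; apply=> j.
  by rewrite dderiv_len_poly !coordsK hE // mulr0.
(* Dual directions: to first order, moving along [g j] changes the [j]-th squared length at unit
   rate and no other one of the family. *)
have /choice[g gP] (j : 'I_m.+1) := dderiv_onto x_gen (fun i => (i == j)%:R) y'i.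
pose mv (z : 'I_m.+1 -> R) (k : 'I_n) := x k + \sum_j z j * g j k.
pose rz z := placement (fun u i => idx u i) (mv z).
have rzE z u i : rz z u 0 i = rho u 0 i + \sum_j z j * g j (idx u i).
  by rewrite /rz mxE /mv /x /coords enum_rankK.
have rz0 : rz (fun=> 0) = rho.
  apply/funext => u; apply/rowP => i; rewrite rzE big1 ?addr0 // => j _.
  by rewrite mul0r.
have c_rz u i : cont0 (fun z => rz z u 0 i).
  rewrite (_ : (fun z => _) = fun z => rho u 0 i + \sum_j z j * g j (idx u i)).
    apply: cont0D; first exact: cont0_cst.
    by apply: cont0_sum => j; apply: cont0M; [exact: cont0_proj | exact: cont0_cst].
  by apply/funext => z; rewrite rzE.
have c_sq (f : ('I_m.+1 -> R) -> 'rV[R]_d) : (forall i, cont0 (fun z => f z 0 i)) ->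
    cont0 (fun z => sqnorm (f z)).
  by move=> cf; apply: cont0_sum => i; apply: cont0M; exact: cf.
have c_sub (f1 f2 : ('I_m.+1 -> R) -> 'rV[R]_d) :
    (forall i, cont0 (fun z => f1 z 0 i)) -> (forall i, cont0 (fun z => f2 z 0 i)) ->
    forall i, cont0 (fun z => (f1 z - f2 z) 0 i).
  move=> c1 c2 i; rewrite (_ : (fun z => _) = fun z => f1 z 0 i + -1 * f2 z 0 i).
    by apply: cont0D; [exact: c1 | apply: cont0M; [exact: cont0_cst | exact: c2]].
  by apply/funext => z; rewrite !mxE mulN1r.
pose al i j (c : 'I_d) := g j (idx (y' i).1 c) - g j (idx (y' i).2 c).
(* Squared lengths are quadratic in the displacement, so beyond the linear part [z i] the error is
   exactly this sum of squares. *)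
pose q i (z : 'I_m.+1 -> R) := \sum_c (\sum_j z j * al i j c) ^+ 2.
have lenE i z : sqnorm (rz z (y' i).1 - rz z (y' i).2) =
    sqnorm (rho (y' i).1 - rho (y' i).2) + (z i + q i z).
  pose p c := rho (y' i).1 0 c - rho (y' i).2 0 c.
  have rzB c : rz z (y' i).1 0 c - rz z (y' i).2 0 c = p c + \sum_j z j * al i j c.
    rewrite !rzE opprD addrACA -sumrB; congr (_ + _).
    by apply: eq_bigr => j _; rewrite mulrBr.
  have zE : z i = \sum_c p c * (\sum_j z j * al i j c) *+ 2.
    transitivity (\sum_j z j * (i == j)%:R).
      rewrite (bigD1 i) //= eqxx mulr1 big1 ?addr0 // => j ji.
      by rewrite eq_sym (negPf ji) mulr0.
    under eq_bigr => j _.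
      rewrite -(gP j i) dderiv_len_poly coordsK /dotr mulrA mulr_sumr; over.
    rewrite exchange_big; apply: eq_bigr => c _ /=.
    rewrite -[RHS]mulr_natl !mulr_sumr; apply: eq_bigr => j _.
    by rewrite !mxE /p /al; ring.
  rewrite /sqnorm zE /q -!big_split /=; apply: eq_bigr => c _.
  have subE (v w : 'rV[R]_d) : (v - w) 0 c = v 0 c - w 0 c by rewrite !mxE.
  by rewrite !subE rzB sqrrD -addrA.
have [C C0 qL] : exists2 C, 0 <= C & forall i z z' r s, (forall i, `|z i| <= r) ->
    (forall i, `|z' i| <= r) -> (forall i, `|z i - z' i| <= s) ->
    `|q i z - q i z'| <= C * r * s.
  pose A i c := \sum_j `|al i j c|.
  have A0 i c : 0 <= A i c by apply: sumr_ge0.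
  have lin i c (w : 'I_m.+1 -> R) t : (forall j, `|w j| <= t) ->
      `|\sum_j w j * al i j c| <= A i c * t.
    move=> wt; apply: le_trans (ler_norm_sum _ _ _) _; rewrite /A mulr_suml.
    by apply: ler_sum => j _; rewrite normrM mulrC ler_wpM2l.
  exists (\sum_i \sum_c 2 * A i c ^+ 2).
    by apply: sumr_ge0 => i _; apply: sumr_ge0 => c _; rewrite mulr_ge0 ?sqr_ge0.
  move=> i z z' r s zr z'r zs.
  have r0 : 0 <= r by apply: le_trans (zr i).
  have s0 : 0 <= s by apply: le_trans (zs i).
  apply: le_trans (_ : (\sum_c 2 * A i c ^+ 2) * r * s <= _); last first.
    rewrite !ler_wpM2r // [leRHS](bigD1 i) //= lerDl.
    by apply: sumr_ge0 => k _; apply: sumr_ge0 => c _; rewrite mulr_ge0 ?sqr_ge0.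
  rewrite /q -sumrB; apply: le_trans (ler_norm_sum _ _ _) _.
  rewrite !mulr_suml; apply: ler_sum => c _.
  rewrite subr_sqr normrM -sumrB -big_split /=.
  under eq_bigr => j _ do rewrite -mulrBl.
  under [X in `|_| * `|X|]eq_bigr => j _ do rewrite -mulrDl.
  rewrite [leRHS](_ : _ = A i c * s * (A i c * (r + r))); last by ring.
  apply: ler_pM => //; apply: lin => j //.
  by apply: le_trans (ler_normD _ _) _; apply: lerD.
have q0 i : q i (fun=> 0) = 0.
  rewrite /q big1 // => c _; rewrite big1 ?expr0n // => j _; exact: mul0r.
have [t t0 tP] : near0 (fun z => (forall u, eucl_norm (rho u - rz z u) < eps) /\
    forall uv : W * W, [set uv.1; uv.2]%SET \in edges G ->
      (forall j : 'I_m, sqnorm (rz z (y j).1 - rz z (y j).2) =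
                 sqnorm (rho (y j).1 - rho (y j).2)) ->
      sqnorm (rz z uv.1 - rz z uv.2) = sqnorm (rho uv.1 - rho uv.2)).
  apply: near0I; apply: near0_all; [move=> u | move=> uv].
    have cu : cont0 (fun z => sqnorm (rho u - rz z u)).
      by apply: c_sq; apply: c_sub => i; [exact: cont0_cst | exact: c_rz].
    apply: near0_sub (cu (eps ^+ 2) (exprn_gt0 _ eps0)) => z.
    rewrite rz0 subrr [sqnorm 0]big1 ?subr0 => [|i _]; last by rewrite mxE expr0n.
    move=> h1; rewrite /eucl_norm -(gtr0_norm eps0) -sqrtr_sqr ltr_sqrt ?exprn_gt0 //.
    exact: le_lt_trans (ler_norm _) h1.
  have [uvE|uvE] := boolP ([set uv.1; uv.2]%SET \in edges G); last first.
    by exists 1.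
  have [P P0 LP] : exists2 P, P != 0 &
      mmap (@mpolyC n rat) (snoc (fun j => L (y j)) (L uv)) P = 0.
    apply: contrapT => nex; apply: (ymax uv uvE) => P LP; apply/eqP/negPn/negP => P0.
    by apply: nex; exists P.
  (* The equation of the edge [uv] over the basis lengths at [rho]; as its roots are isolated,
     continuity pins the length of [uv]. *)
  pose p := map_poly (mmap (ratr : rat -> R) (fun j => mmap ratr x (L (y j)))) (muni P).
  have p0 : p != 0.
    apply: contraNneq P0 => /polyP p0; apply/eqP/muni_inj; rewrite muni0.
    apply/polyP => i; rewrite coef0; apply: yi; apply: x_gen.
    by rewrite mmap_mmap; have := p0 i; rewrite coef_map coef0.
  have [gap gap0 gapP] := root_isolated (sqnorm (rho uv.1 - rho uv.2)) p0.
  have cuv : cont0 (fun z => sqnorm (rz z uv.1 - rz z uv.2)).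
    by apply: c_sq; apply: c_sub => i; exact: c_rz.
  apply: near0_sub (cuv _ gap0) => z; rewrite rz0 => h1 _ h2; apply: gapP => //.
  have := congr1 (mmap (ratr : rat -> R) (mv z)) LP.
  rewrite mmap0 mmap_mmap.
  rewrite [X in mmap _ X _](_ : _ = snoc (fun j => mmap ratr x (L (y j)))
      (sqnorm (rz z uv.1 - rz z uv.2))); last first.
    apply/funext => j; rewrite /snoc; case: unliftP => [i|] _ /=; rewrite len_polyE //.
    by rewrite -/(rz z) h2 len_polyE coordsK.
  by rewrite mmap_snoc /root => ->.
have [del del0 delP] := newton_quadratic C0 t0 q0 qL.
(* Prescribed: the basis lengths stay and the squared length of [ab] grows by [del]. *)
have [|z zt zP] := delP (fun i => if i == ord_max then del else 0).
  by move=> j; case: ifP; rewrite ?normr0 ?gtr0_norm // ltW.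
have [h1 h2] := tP z zt.
have sq_ge0 (v : 'rV[R]_d) : 0 <= sqnorm v by apply: sumr_ge0 => i _; exact: sqr_ge0.
have y_eq (j : 'I_m) : sqnorm (rz z (y j).1 - rz z (y j).2) =
    sqnorm (rho (y j).1 - rho (y j).2).
  have := lenE (widen_ord (leqnSn m) j) z; rewrite zP /y' snoc_widen => ->.
  by rewrite -val_eqE /= ltn_eqF // addr0.
have := epsP (rz z) _ h1 a b; rewrite /same_dist /eucl_norm => sd.
have : sqnorm (rz z a - rz z b) = sqnorm (rho a - rho b).
  apply/eqP; rewrite -eqr_sqrt //; apply/eqP/sd => u v uvE.
  by rewrite (h2 (u, v) uvE y_eq).
have := lenE ord_max z; rewrite zP /y' snoc_max eqxx /= => -> /eqP.
by rewrite -subr_eq0 addrAC subrr add0r gt_eqF.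
Qed.
End InfinitesimalRigidity.

(** * Nondegenerate placements *)

Lemma sqnormE (K : fieldType) d (x : 'rV[K]_d) : sqnorm x = (x *m x^T) 0 0.
Proof. by rewrite mxE; apply: eq_bigr => i _; rewrite mxE expr2. Qed.

Section Frame.
Variables (K : numClosedFieldType) (m : nat) (W : finType).
Variables (v0 : W) (f : 'I_m -> W).
Implicit Types rho sigma : W -> 'rV[K]_(1 + m).

Definition frame rho : 'M[K]_(m, 1 + m) := \matrix_i (rho (f i) - rho v0).
Definition gram rho : 'M[K]_m := frame rho *m (frame rho)^T.

Definition unit_normal rho (nu : 'rV[K]_(1 + m)) : Prop :=
  nu *m (frame rho)^T = 0 /\ nu *m nu^T = 1%:M.

Lemma frame_normalE rho nu : unit_normal rho nu ->
  col_mx nu (frame rho) *m (col_mx nu (frame rho))^T =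
  block_mx 1%:M 0 0 (gram rho).
Proof.
case=> nuF nu1; rewrite tr_col_mx mul_col_row nuF nu1.
by rewrite -[frame rho *m _]trmxK trmx_mul trmxK nuF trmx0.
Qed.

Lemma frame_normal_unit rho nu : gram rho \in unitmx -> unit_normal rho nu ->
  col_mx nu (frame rho) \in unitmx.
Proof.
move=> gu nuP; have := frame_normalE nuP => e.
have : col_mx nu (frame rho) *m (col_mx nu (frame rho))^T \in unitmx.
  by rewrite e unitmxE det_ublock det1 mul1r -unitmxE.
by rewrite unitmx_mul => /andP[].
Qed.

(** A nonzero normal and the frame form a basis, so an isotropic normal would be orthogonal to the
    whole space; hence it can be rescaled. *)
Lemma exists_unit_normal rho : gram rho \in unitmx -> exists nu, unit_normal rho nu.
Proof.
move=> gu; set Fr := frame rho.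
have : kermx Fr^T != 0.
  by rewrite -mxrank_eq0 mxrank_ker subn_eq0 -ltnNge (leq_ltn_trans (rank_leq_col _)).
case/rowV0Pn=> nu; rewrite sub_kermx => /eqP nuF nu0.
have B_free : row_free (col_mx nu Fr).
  rewrite -kermx_eq0; apply/rowV0P => w; rewrite sub_kermx => /eqP.
  rewrite -[w]hsubmxK mul_row_col => e.
  have := congr1 (mulmx^~ Fr^T) e; rewrite mulmxDl -!mulmxA nuF mulmx0 add0r mul0mx.
  move=> /(congr1 (mulmx^~ (invmx (gram rho)))); rewrite mulmxK // mul0mx => r0.
  move: e; rewrite r0 mul0mx addr0 [lsubmx w]mx11_scalar mul_scalar_mx => /eqP.
  rewrite scaler_eq0 (negPf nu0) orbF => /eqP ->.
  by rewrite -scalemx1 scale0r row_mx0.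
have Bu : col_mx nu Fr \in unitmx by rewrite -row_free_unit.
have nn0 : (nu *m nu^T) 0 0 != 0.
  apply: contraNneq nu0 => nn; rewrite -trmx_eq0 -(mulKmx Bu nu^T) mul_col_mx.
  rewrite [nu *m _]mx11_scalar nn -[Fr *m _]trmxK trmx_mul trmxK nuF trmx0.
  by rewrite -scalemx1 scale0r col_mx0 mulmx0.
set s := sqrtC ((nu *m nu^T) 0 0); exists (s^-1 *: nu); split.
  by rewrite -scalemxAl nuF scaler0.
rewrite linearZ /= -scalemxAl -scalemxAr scalerA [nu *m _]mx11_scalar.
rewrite scale_scalar_mx -invfM -expr2 sqrtCK mulVf //.
Qed.

Lemma normal_line rho nu (w : 'rV[K]_(1 + m)) :
  gram rho \in unitmx -> unit_normal rho nu -> w *m (frame rho)^T = 0 ->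
  w = (w *m nu^T) 0 0 *: nu.
Proof.
move=> gu nuP wF; have Bu := frame_normal_unit gu nuP.
have BTu : (col_mx nu (frame rho))^T \in unitmx by rewrite unitmx_tr.
apply: (can_inj (mulmxK BTu)); case: nuP => nuF nu1.
rewrite tr_col_mx -scalemxAl !mul_mx_row wF nuF nu1 scale_row_mx scaler0.
by rewrite {1}[w *m nu^T]mx11_scalar scalemx1.
Qed.

(** [A] fixes the frame, hence scales the normal line, and determinant 1 forces the scale [c] to be
    1. *)
Lemma direct_stabilizer rho (A : 'M[K]_(1 + m)) b :
  gram rho \in unitmx -> A *m A^T = 1%:M -> \det A = 1 ->
  (forall v, rho v = rho v *m A + b) -> A = 1%:M /\ b = 0.
Proof.
move=> gu AA dA fixA; have [nu nuP] := exists_unit_normal gu.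
have FA : frame rho *m A = frame rho.
  apply/row_matrixP => i; rewrite row_mul !rowK mulmxBl.
  by rewrite [in RHS]fixA [rho v0 in RHS]fixA opprD addrACA subrr addr0.
have nuA : nu *m A *m (frame rho)^T = 0.
  by rewrite -FA trmx_mul -mulmxA (mulmxA A) AA mul1mx; case: nuP.
have Bu := frame_normal_unit gu nuP.
have nuE := normal_line gu nuP nuA; set c := _ 0 0 in nuE.
have BA : col_mx nu (frame rho) *m A =
    block_mx c%:M 0 0 1%:M *m col_mx nu (frame rho).
  by rewrite mul_col_mx FA mul_block_col !mul0mx mul1mx addr0 add0r mul_scalar_mx -nuE.
have c1 : c = 1.
  have := congr1 determinant BA; rewrite !det_mulmx dA mulr1 det_ublock det1 mulr1.
  rewrite det_scalar1 => /esym; rewrite -[RHS]mul1r => /mulIf; apply.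
  by rewrite -unitfE -unitmxE.
have A1 : A = 1%:M.
  apply: (can_inj (mulKmx Bu)); rewrite BA c1 mulmx1 -scalar_mx_block mul1mx //.
split=> //; have := fixA v0; rewrite A1 mulmx1 -[LHS]addr0.
by move=> /addrI <-.
Qed.

Lemma polarization d (x y : 'rV[K]_d) :
  (x *m y^T) 0 0 = (sqnorm x + sqnorm y - sqnorm (x - y)) / 2.
Proof.
rewrite /sqnorm mxE -big_split -sumrB mulr_suml; apply: eq_bigr => i _.
by rewrite !mxE /=; field.
Qed.

(** The normal and the frame form a basis with block-diagonal Gram matrix; inverting that matrix
    expands the product in coordinates. *)
Lemma frame_expand rho nu (x y : 'rV[K]_(1 + m)) :
  gram rho \in unitmx -> unit_normal rho nu ->
  x *m y^T = x *m nu^T *m (y *m nu^T)^T +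
    x *m (frame rho)^T *m invmx (gram rho) *m (y *m (frame rho)^T)^T.
Proof.
move=> gu nuP; have := frame_normalE nuP; set B := col_mx _ _ => BB.
have BTE z : z *m B^T = row_mx (z *m nu^T) (z *m (frame rho)^T) :> 'rV_(1 + m).
  by rewrite /B tr_col_mx mul_mx_row.
pose Gi := block_mx 1%:M 0 0 (invmx (gram rho)) : 'M[K]_(1 + m).
have GG : B *m (B^T *m Gi) = 1%:M.
  rewrite mulmxA BB mulmx_block !(mulmx0, mul0mx, mul1mx, addr0, add0r) mulmxV //.
  by rewrite -scalar_mx_block.
have -> : x *m y^T = x *m B^T *m Gi *m (y *m B^T)^T.
  rewrite trmx_mul trmxK mulmxA -(mulmxA x B^T) -(mulmxA x) (mulmx1C GG).
  by rewrite mulmx1.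
rewrite !BTE mul_row_block !(mulmx0, add0r, addr0) mulmx1 tr_row_mx mul_row_col //.
Qed.

(* Lengths determine the components along the normals up to a common sign,
   which is absorbed in the choice of the normal of [sigma]; the resulting
   isometry may reverse the orientation. *)
Lemma congruent_of_lengths rho sigma : gram rho \in unitmx ->
  (forall u v, sqnorm (sigma u - sigma v) = sqnorm (rho u - rho v)) ->
  exists A b, A *m A^T = 1%:M /\ forall v, sigma v = rho v *m A + b.
Proof.
move=> gu len.
pose w u := rho u - rho v0; pose w' u := sigma u - sigma v0.
have dot_eq u v : w' u *m (w' v)^T = w u *m (w v)^T.
  rewrite [LHS]mx11_scalar [RHS]mx11_scalar !polarization /w /w' !len.
  have subsub (g : W -> 'rV[K]_(1 + m)) : g u - g v0 - (g v - g v0) = g u - g v.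
    by rewrite opprB addrA subrK.
  by rewrite !subsub len.
have frameE (g : W -> 'rV[K]_(1 + m)) (x : 'rV[K]_(1 + m)) :
    x *m (frame g)^T = \row_i (x *m (g (f i) - g v0)^T) 0 0.
  by apply/rowP => i; rewrite !mxE; apply: eq_bigr => j _; rewrite !mxE.
have wF u : w' u *m (frame sigma)^T = w u *m (frame rho)^T.
  by rewrite !frameE; apply/rowP => i; rewrite [LHS]mxE [RHS]mxE -/(w' _) -/(w _) dot_eq.
have gramE : gram sigma = gram rho.
  by apply/row_matrixP => i; rewrite !row_mul !rowK -/(w' _) -/(w _) wF.
have gu' : gram sigma \in unitmx by rewrite gramE.
have [nu nuP] := exists_unit_normal gu.
have [nu1 nu1P] := exists_unit_normal gu'.
have ss u v : (w' u *m nu1^T) 0 0 * (w' v *m nu1^T) 0 0 =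
    (w u *m nu^T) 0 0 * (w v *m nu^T) 0 0.
  have := dot_eq u v; rewrite (frame_expand (w u) (w v) gu nuP).
  rewrite (frame_expand (w' u) (w' v) gu' nu1P).
  rewrite !wF gramE => /addIr /matrixP/(_ 0 0).
  by rewrite !mxE !big_ord1 !mxE.
have [eps eps2 sE] : exists2 eps : K, eps * eps = 1 &
    forall u, (w' u *m nu1^T) 0 0 = eps * (w u *m nu^T) 0 0.
  (* The sign is the ratio of normal components wherever these are nonzero; if [rho] lies in the
     hyperplane, either sign would do. *)
  have [[u0 u0P]|all0] := pselect (exists u, (w u *m nu^T) 0 0 != 0).
    have e : ((w' u0 *m nu1^T) 0 0 / (w u0 *m nu^T) 0 0) *
        ((w' u0 *m nu1^T) 0 0 / (w u0 *m nu^T) 0 0) = 1.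
      by rewrite mulrACA ss mulrACA mulfV // mulr1.
    exists ((w' u0 *m nu1^T) 0 0 / (w u0 *m nu^T) 0 0) => // u.
    have := ss u0 u; move: e u0P; set a := _ 0 0; set b := _ 0 0.
    set c := _ 0 0; set s := _ 0 0 => e b0 acbs.
    have a0 : a != 0.
      apply: contra_eq_neq e => ->; rewrite mul0r mul0r eq_sym; exact: oner_neq0.
    apply: (mulfI a0); rewrite acbs mulrA mulrA -[LHS]mul1r -e; field.
    exact: b0.
  exists 1; first by rewrite mulr1.
  have z u : (w u *m nu^T) 0 0 = 0.
    by apply/eqP/negPn/negP => h; apply: all0; exists u.
  move=> u; rewrite z mulr0; apply/eqP; rewrite -[_ == 0]orbb -mulf_eq0 ss z.
  by rewrite mulr0.
have nu2P : unit_normal sigma (eps *: nu1).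
  case: nu1P => h1 h2; split; first by rewrite -scalemxAl h1 scaler0.
  by rewrite linearZ /= -scalemxAl -scalemxAr scalerA eps2 scale1r.
have s2E u : w' u *m (eps *: nu1)^T = w u *m nu^T.
  rewrite [LHS]mx11_scalar [RHS]mx11_scalar linearZ /= -scalemxAr mxE sE mulrA.
  by rewrite eps2 mul1r.
pose B := col_mx nu (frame rho); pose B' := col_mx (eps *: nu1) (frame sigma).
have Bu : B \in unitmx := frame_normal_unit gu nuP.
have B'u : B' \in unitmx := frame_normal_unit gu' nu2P.
have BB : B' *m B'^T = B *m B^T.
  by rewrite (frame_normalE nuP) (frame_normalE nu2P) gramE.
have wB u : w' u *m B'^T = w u *m B^T.
  by rewrite !tr_col_mx !mul_mx_row s2E wF.
have AA : invmx B *m B' *m (invmx B *m B')^T = 1%:M.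
  rewrite trmx_mul -mulmxA (mulmxA B') BB trmx_inv -mulmxA mulmxV ?unitmx_tr //.
  by rewrite mulmx1 mulVmx.
exists (invmx B *m B'), (sigma v0 - rho v0 *m (invmx B *m B')); split=> // v.
suff wA : w v *m (invmx B *m B') = w' v.
  by rewrite addrCA -mulmxBl wA addrC subrK.
apply: (can_inj (mulmxK (_ : B'^T \in unitmx))); first by rewrite unitmx_tr.
by rewrite wB -!mulmxA BB mulKmx.
Qed.
End Frame.

(** * Extensions of a placement of H *)

Lemma sqnorm_mulmx (K : fieldType) d (x : 'rV[K]_d) (A : 'M[K]_d) :
  A *m A^T = 1%:M -> sqnorm (x *m A) = sqnorm x.
Proof.
by move=> AA; rewrite !sqnormE trmx_mul mulmxA -(mulmxA x) AA mulmx1.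
Qed.

Lemma set2_eq (T : finType) (a b c e : T) :
  [set a; b]%SET = [set c; e]%SET -> a = c /\ b = e \/ a = e /\ b = c.
Proof.
move=> abce; have ha := set21 a b; have hb := set22 a b; rewrite abce in ha hb.
have hc := set21 c e; have he := set22 c e; rewrite -abce in hc he.
move: ha hb hc he.
by case/set2P=> h1; case/set2P=> h2; case/set2P=> h3; case/set2P=> h4; subst; auto.
Qed.

Definition mk_edge (W : finType) (G : graph W) (e : {set W}) (eG : e \in edges G) :
  {e : {set W} | e \in edges G} := exist (fun f => f \in edges G) e eG.

Section Restriction.
Variables (V : finType) (G : graph V) (H : subgraph G).

Lemma edge_of_sub_proof (e : {e : {set {v : V | v \in sverts H}} | e \in edges (graph_of H)}) :
  [set val x | x in val e]%SET \in edges G.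
Proof.
by case: e => e /=; rewrite inE; apply: (fintype.subsetP (sedges_sub H)).
Qed.

Definition edge_of_sub e : {e : {set V} | e \in edges G} :=
  mk_edge (edge_of_sub_proof e).

Lemma edge_of_sub_inj : injective edge_of_sub.
Proof. by move=> e e' /(congr1 val)/imset_inj-/(_ val_inj)/val_inj. Qed.
End Restriction.

Definition extensions (K : fieldType) d (U W : finType) (j : U -> W) (G : graph W)
    (l : {e : {set W} | e \in edges G} -> K) (rho : U -> 'rV[K]_d) :
    set (W -> 'rV[K]_d) :=
  [set tau | realizations l tau /\ tau \o j = rho]%classic.

Section ExtensionNumber.
Variables (R : realType) (K : numClosedFieldType) (m : nat).
Hypothesis uncK : (~ countable [set: K])%classic.
Variables (V : finType) (G : graph V) (H : subgraph G).
Local Notation VH := {v : V | v \in sverts H}.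
Local Notation E := {e : {set V} | e \in edges G}.
Local Notation d := (1 + m)%N.
Hypothesis rigH : rigid R d (graph_of H).
Variables (v0 : VH) (fv : 'I_m -> VH).
Hypothesis fv_inj : injective fv.
Hypothesis fv0 : forall i, fv i != v0.

Local Notation I := (VH * 'I_d + E)%type.
Local Notation n := #|{: I}|.
Local Notation idx := (fun (u : VH) (i : 'I_d) => enum_rank (inl (u, i) : I)).
Local Notation L := (len_poly idx).

(* The variables are the coordinates of the vertices of [H] and one variable for
   each edge of [G]; the variables of the edges of [H] are never used. *)
Definition edge_poly (e : E) : {mpoly rat[n]} :=
  if [pick p : VH * VH | (val e \in sedges H) &&
        (val e == [set val p.1; val p.2]%SET)] is Some p
  then L p.1 p.2 else 'X_(enum_rank (inr e : I)).

Definition point (F : Type) (rho : VH -> 'rV[F]_d) (l : E -> F) (k : 'I_n) : F :=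
  match enum_val k with inl (u, i) => rho u 0 i | inr e => l e end.

Lemma placement_point (F : fieldType) (rho : VH -> 'rV[F]_d) (l : E -> F) :
  placement idx (point rho l) = rho.
Proof. by apply/funext => u; apply/rowP => i; rewrite mxE /point enum_rankK. Qed.

Definition compatible (l : E -> K) (rho : VH -> 'rV[K]_d) : Prop :=
  alg_independent l /\ realizations (l \o @edge_of_sub V G H) rho.

Lemma edge_polyE (l : E -> K) (rho : VH -> 'rV[K]_d) e :
  realizations (l \o @edge_of_sub V G H) rho ->
  mmap ratr (point rho l) (edge_poly e) = l e.
Proof.
move=> rl; rewrite /edge_poly; case: pickP => [[u v] /= /andP[eH /eqP euv]|_].
  have eP : [set u; v]%SET \in edges (graph_of H).
    by rewrite inE imsetU1 imset_set1 -euv.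
  rewrite len_polyE placement_point (rl (mk_edge eP) u v) //=; congr l.
  by apply/val_inj; rewrite /= imsetU1 imset_set1.
by rewrite mmapX mmap1U /point enum_rankK.
Qed.

Local Notation J := (VH * VH + E)%type.

(** All squared distances within [H] are listed, not only those of edges, because together they
    determine a placement up to isometry. *)
Definition all_polys (k : 'I_#|{: J}|) : {mpoly rat[n]} :=
  match enum_val k with inl p => L p.1 p.2 | inr e => edge_poly e end.

Definition eval_at (l : E -> K) (rho : VH -> 'rV[K]_d) :
    {mpoly rat[#|{: J}|]} -> K :=
  mmap ratr (fun k => mmap ratr (point rho l) (all_polys k)).

(** By rigidity of [H], a direction that preserves the edge polynomials to first order preserves all
    listed polynomials, so [nonzero_at_indep] applies with the edge polynomials as [q]. *)
Lemma eval_at_neq0 l rho Q : compatible l rho ->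
  mmap (@mpolyC n rat) all_polys Q != 0 -> eval_at l rho Q != 0.
Proof.
move=> [l_indep rl]; rewrite /eval_at -mmap_mmap.
(* Rigidity concerns real placements: derivatives are taken at a real generic point, while the
   nonvanishing is claimed over [K]. *)
have [xi xi_indep] := exists_alg_independent I (@real_uncountable R).
pose x (k : 'I_n) := xi (enum_val k).
have x_gen : generic_point x by exact: xi_indep.
have rx_gen : generic_realization (placement idx x).
  have := alg_independent_inj (h := inl : VH * 'I_d -> I) _ xi_indep.
  rewrite /generic_realization [X in _ -> alg_independent X](_ : _ = xi \o inl).
    by apply=> ? ? [].
  by apply/funext => -[u i]; rewrite /= mxE /x enum_rankK.
apply: (nonzero_at_indep (m := #|{: E}|) (q := fun k => edge_poly (enum_val k)) x_gen).
  move=> h hq; rewrite dderiv_mmap /dderiv big1 // => k _.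
  suff : dderiv (mmap (ratr : rat -> R) x) h (all_polys k) = 0.
    by rewrite /dderiv => ->; rewrite mul0r.
  have hE e : dderiv (mmap (ratr : rat -> R) x) h (edge_poly e) = 0.
    by rewrite -[e]enum_rankK hq.
  rewrite /all_polys; case: (enum_val k) => [[a b]|e] //=.
  rewrite dderiv_len_poly (rigid_infinitesimal rigH rx_gen) ?mulr0 // => u v uvE.
  have := hE (edge_of_sub (mk_edge uvE)); rewrite /edge_poly.
  case: pickP => [[u' v'] /= /andP[_ /eqP]|/(_ (u, v))]; last first.
    have := uvE; rewrite inE /= imsetU1 imset_set1 => uvH.
    by rewrite uvH eqxx.
  rewrite imsetU1 imset_set1 dderiv_len_poly => uv /eqP.
  rewrite mulf_eq0 pnatr_eq0 /= => /eqP.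
  have : (u = u' /\ v = v') \/ (u = v' /\ v = u').
    by case: (set2_eq uv) => -[/val_inj -> /val_inj ->]; [left | right].
  case=> -[-> ->] // <-; apply: eq_bigr => i _; rewrite !mxE; ring.
by move=> P; rewrite (_ : (fun j => _) = fun j => l (enum_val j)); [exact: l_indep|];
  apply/funext => j; rewrite edge_polyE.
Qed.

(** A relation either is an identity between the polynomials or fails at every compatible pair. *)
Lemma eval_at_same_kernel l rho l' rho' : compatible l rho -> compatible l' rho' ->
  same_kernel (eval_at l rho) (eval_at l' rho').
Proof.
move=> lr lr' Q.
have [z0|z0] := eqVneq (mmap (@mpolyC n rat) all_polys Q) 0; last first.
  by split=> /eqP; rewrite (negPf (eval_at_neq0 _ z0)).
by rewrite /eval_at -!mmap_mmap z0 !mmap0.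
Qed.

Definition lenX (u v : VH) : {mpoly rat[#|{: J}|]} := 'X_(enum_rank (inl (u, v) : J)).

Lemma eval_lenX l rho u v : eval_at l rho (lenX u v) = sqnorm (rho u - rho v).
Proof.
rewrite /eval_at mmapX mmap1U /all_polys enum_rankK /=.
by rewrite len_polyE placement_point.
Qed.

Lemma eval_edgeX l rho e : realizations (l \o @edge_of_sub V G H) rho ->
  eval_at l rho 'X_(enum_rank (inr e : J)) = l e.
Proof.
by move=> rl; rewrite /eval_at mmapX mmap1U /all_polys enum_rankK /= edge_polyE.
Qed.

(* The Gram determinant is a polynomial in the squared distances, so it is
   enough that it be nonzero at one placement, here an orthonormal frame. *)
Lemma gram_unit l rho : compatible l rho -> gram v0 fv rho \in unitmx.
Proof.
move=> lr.
pose M : 'M[{mpoly rat[#|{: J}|]}]_m := \matrix_(i, j)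
  ((2^-1)%:MP * (lenX (fv i) v0 + lenX (fv j) v0 - lenX (fv i) (fv j))).
have detE l1 rho1 : eval_at l1 rho1 (\det M) = \det (gram v0 fv rho1).
  rewrite /eval_at -det_map_mx; congr determinant; apply/matrixP => i j.
  rewrite !mxE /= mmapM mmapB mmapD mmapC -!/(eval_at _ _ _) !eval_lenX /= fmorphV.
  rewrite mulrC (_ : (\sum_k _) = ((rho1 (fv i) - rho1 v0) *m
    (rho1 (fv j) - rho1 v0)^T) 0 0); last first.
    by rewrite !mxE; apply: eq_bigr => k _; rewrite !mxE.
  rewrite polarization opprB addrA subrK rmorph_nat //.
rewrite unitmxE unitfE -(detE l); apply: eval_at_neq0 => //.
(* [v0] goes to the origin and the [fv i] to distinct unit vectors. The zero lengths used with
   [rho1] are a dummy, since [M] involves only distances. *)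
pose rho1 (v : VH) : 'rV[K]_(1 + m) :=
  \row_k (if [pick i | fv i == v] is Some i then (k == rshift 1 i)%:R else 0).
apply: contraTneq isT => z0; have := detE (fun=> 0) rho1.
rewrite /eval_at -mmap_mmap z0 mmap0 => /esym.
suff -> : gram v0 fv rho1 = 1%:M by rewrite det1 => /eqP; rewrite oner_eq0.
have r1 i : rho1 (fv i) = delta_mx 0 (rshift 1 i).
  apply/rowP => k; rewrite !mxE; case: pickP => [j /eqP/fv_inj ->|/(_ i)].
    by rewrite eqxx.
  by rewrite eqxx.
have r0 : rho1 v0 = 0.
  apply/rowP => k; rewrite !mxE; case: pickP => // i; by rewrite (negPf (fv0 i)).
have frE i k : frame v0 fv rho1 i k = (k == rshift 1 i)%:R.
  by rewrite /frame mxE r1 r0 subr0 mxE eqxx.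
apply/matrixP => i j; rewrite /gram [LHS]mxE (bigD1 (rshift 1 i)) //= big1 => [|k ki].
  by rewrite [_^T _ _]mxE !frE eqxx mul1r addr0 (inj_eq (@rshift_inj _ _)) mxE.
by rewrite frE (negPf ki) mul0r.
Qed.

(** The coordinates of [rho] and of its [N] extensions are copied over the second pair; the copy of
    [rho] has the distances of [rho'], so an isometry moves it onto [rho']. *)
Lemma extensions_transfer l rho l' rho' N (tau : 'I_N -> V -> 'rV[K]_d) :
  compatible l rho -> compatible l' rho' -> injective tau ->
  (forall k, extensions val l rho (tau k)) ->
  exists tau' : 'I_N -> V -> 'rV[K]_d,
    injective tau' /\ forall k, extensions val l' rho' (tau' k).
Proof.
move=> lr lr' tau_inj tauP.
pose Z := (VH * 'I_d + 'I_N * V * 'I_d)%type.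
pose zc (z : Z) : K := match z with
  | inl (u, i) => rho u 0 i | inr (k, v, i) => tau k v 0 i end.
pose f : {rmorphism {mpoly rat[#|{: J}|]} -> K} :=
  mmap ratr (fun k => mmap ratr (point rho l) (all_polys k)).
pose g : {rmorphism {mpoly rat[#|{: J}|]} -> K} :=
  mmap ratr (fun k => mmap ratr (point rho' l') (all_polys k)).
have fg : same_kernel f g := eval_at_same_kernel lr lr'.
have [B [f' [g' [i [y [_ fg' f'i g'i f'y]]]]]] :=
  same_kernel_lift uncK zc (countable_mpoly _) fg.
have {}f'y z : f' (y z) = zc z := f'y z.
pose sg (u : VH) : 'rV[K]_d := \row_c g' (y (inl (u, c))).
pose ta k (v : V) : 'rV[K]_d := \row_c g' (y (inr (k, v, c))).
have transfer (P : B) : f' P = 0 -> g' P = 0 by move/fg'.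
have sg_len a b : sqnorm (sg a - sg b) = sqnorm (rho' a - rho' b).
  have := transfer (\sum_c (y (inl (a, c)) - y (inl (b, c))) ^+ 2 - i (lenX a b)).
  rewrite !rmorphB !rmorph_sum /= [f' (i _)]f'i [g' (i _)]g'i.
  rewrite [f _]eval_lenX [g _]eval_lenX => h.
  have {}h := h _.
  apply/eqP; rewrite -subr_eq0; apply/eqP; rewrite -[RHS]h.
    congr (_ - _); apply: eq_bigr => c _.
    by rewrite rmorphXn rmorphB !mxE.
  apply/eqP; rewrite subr_eq0; apply/eqP; apply: eq_bigr => c _.
  by rewrite rmorphXn rmorphB /= !f'y !mxE.
have ta_len k (e : E) u v : val e = [set u; v]%SET -> sqnorm (ta k u - ta k v) = l' e.
  move=> euv; have := transfer (\sum_c (y (inr (k, u, c)) - y (inr (k, v, c))) ^+ 2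
     - i 'X_(enum_rank (inr e : J))).
  rewrite !rmorphB !rmorph_sum /= [f' (i _)]f'i [g' (i _)]g'i.
  rewrite [f _]eval_edgeX; last by case: lr.
  rewrite [g _]eval_edgeX; last by case: lr'.
  move=> h; apply/eqP; rewrite -subr_eq0; apply/eqP; rewrite -[RHS]h.
    congr (_ - _); apply: eq_bigr => c _.
    by rewrite rmorphXn rmorphB !mxE.
  apply/eqP; rewrite subr_eq0; apply/eqP.
  have [tl _] := tauP k; rewrite -(tl e u v euv); apply: eq_bigr => c _.
  by rewrite rmorphXn rmorphB /= !f'y !mxE.
have ta_ext k (u : VH) : ta k (val u) = sg u.
  apply/rowP => c; rewrite !mxE; apply/eqP; rewrite -subr_eq0 -rmorphB; apply/eqP.
  apply: transfer; rewrite rmorphB /= !f'y /=; have [_ <-] := tauP k.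
  by rewrite subrr.
have [A [b [AA sgE]]] := congruent_of_lengths (gram_unit lr') sg_len.
have AA' : A^T *m A = 1%:M by apply: mulmx1C.
(* The inverse isometry may reverse orientation, which is harmless: it preserves lengths, and
   extensions are not taken modulo congruence. *)
exists (fun k v => (ta k v - b) *m A^T); split=> [k1 k2 e|k].
  apply: tau_inj; apply/funext => v; apply/rowP => c.
  have /(congr1 (mulmx^~ A)) := congr1 (@^~ v) e.
  rewrite -!mulmxA AA' !mulmx1 => /addIr/rowP/(_ c); rewrite !mxE => tc.
  apply/eqP; rewrite -subr_eq0; apply/eqP.
  have := (fg' (y (inr (k1, v, c)) - y (inr (k2, v, c)))).2.
  by rewrite !rmorphB /= tc subrr !f'y; apply.
split=> [e u v euv|].
  rewrite -mulmxBl opprB addrA subrK sqnorm_mulmx ?trmxK //.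
  exact: ta_len.
apply/funext => u; rewrite /= ta_ext sgE addrK -mulmxA AA mulmx1 //.
Qed.
End ExtensionNumber.

(** * Counting classes *)

Section Sizes.
Local Open Scope classical_set_scope.
Local Open Scope card_scope.

Definition has_inj (N : nat) T (A : set T) : Prop :=
  exists f : 'I_N -> T, injective f /\ forall i, A (f i).

Definition enumerated (F : finType) T (A : set T) : Prop :=
  exists f : F -> T, injective f /\ forall x, A x <-> exists i, f i = x.

(* Infinite sets get the value [0], which makes [ncard] multiplicative. *)
Definition ncard T (A : set T) : nat := xget 0%N [set N | A #= `I_N].

Lemma has_inj1 T (A : set T) x : A x -> has_inj 1 A.
Proof. by move=> Ax; exists (fun=> x); split=> // a b _; rewrite (ord1 a) (ord1 b). Qed.

Lemma has_inj_enumerated N (F : finType) T (A : set T) :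
  has_inj N A -> enumerated F A -> (N <= #|F|)%N.
Proof.
move=> [f [finj fA]] [g [ginj gA]].
have /choice[h hP] i : exists j, g j = f i by apply/gA.
rewrite -[N]card_ord; apply: (leq_card h) => i j e.
by apply: finj; rewrite -!hP e.
Qed.

Lemma has_injS N T (A : set T) :
  has_inj N A -> enumerated 'I_N A \/ has_inj N.+1 A.
Proof.
move=> [f [finj fA]].
have [onto|nonto] := pselect (forall x, A x -> exists i, f i = x).
  by left; exists f; split=> // x; split=> [/onto//|[i <-]].
right; have [x [Ax nx]] : exists x, A x /\ ~ exists i, f i = x.
  apply: contrapT => nex; apply: nonto => x Ax; apply: contrapT => nx.
  by apply: nex; exists x.
exists (fun i => oapp f x (unlift ord_max i)); split=> [i j|i].
  case: unliftP => [i' ->|->]; case: unliftP => [j' ->|->] //=.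
  - by move/finj => ->.
  - by move=> e; case: nx; exists i'.
  - by move=> e; case: nx; exists j'.
by case: unliftP => [j _|_] /=; [exact: fA | ].
Qed.

(** Finite cardinalities are thus determined by [has_inj] alone, so transferring [N] elements at a
    time is enough to compare counts. *)
Lemma enumeratedP N T (A : set T) :
  enumerated 'I_N A <-> has_inj N A /\ ~ has_inj N.+1 A.
Proof.
split=> [eA|]; last by case=> /has_injS[].
split.
  by case: eA => f [finj fA]; exists f; split=> // i; apply/fA; exists i.
by move=> /has_inj_enumerated/(_ eA); rewrite card_ord ltnn.
Qed.

Lemma enumerated_or_infinite T (A : set T) :
  (exists N, enumerated 'I_N A) \/ forall N, has_inj N A.
Proof.
have [|nex] := pselect (exists N, enumerated 'I_N A); [by left | right].
elim=> [|N /has_injS[eA|//]]; last by case: nex; exists N.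
have f : 'I_0 -> T by case.
by exists f; split=> [[]|[]].
Qed.

Lemma card_eq_enumerated N T (A : set T) : A #= `I_N <-> enumerated 'I_N A.
Proof.
split=> [AN|[f [finj fA]]].
  have : [set: 'I_N] #= A by apply: card_eq_trans (_ : `I_N #= A);
    rewrite card_eq_sym // card_II.
  move/card_bijP => [g [h gK hK]].
  exists (fun i => val (g (SigSub (in_setT i)))); split=> [i j /val_inj e|x].
    have := congr1 h e; rewrite !gK => /(congr1 val) //.
  split=> [Ax|[i <-]]; last by apply: set_mem; exact: valP.
  exists (val (h (SigSub (mem_set Ax)))).
  rewrite (_ : SigSub _ = h (SigSub (mem_set Ax))); last exact: val_inj.
  by rewrite hK.
have -> : A = f @` [set: 'I_N].
  apply/seteqP; split=> x; first by move=> /fA[i <-]; exists i.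
  by case=> i _ <-; apply/fA; exists i.
apply: card_eq_trans (_ : [set: 'I_N] #= _); last by rewrite card_eq_sym card_II.
by apply: inj_card_eq => i j _ _; exact: finj.
Qed.

Lemma ncard_enumerated (F : finType) T (A : set T) : enumerated F A -> ncard A = #|F|.
Proof.
move=> [f [finj fA]].
have /card_eq_enumerated AF : enumerated 'I_#|F| A.
  exists (f \o enum_val); split=> [i j /= /finj/enum_val_inj //|x].
  rewrite fA; split=> [[i <-]|[i <-]]; last by exists (enum_val i).
  by exists (enum_rank i); rewrite /= enum_rankK.
rewrite /ncard; case: xgetP => [N _ /= AN|/(_ _ AF)//].
by apply/esym/card_eq_II; apply: card_eq_trans AN; rewrite card_eq_sym.
Qed.

Lemma ncard_infinite T (A : set T) : (forall N, has_inj N A) -> ncard A = 0%N.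
Proof.
move=> iA; rewrite /ncard; case: xgetP => // N _ /card_eq_enumerated/enumeratedP.
by case=> _ /(_ (iA _)).
Qed.

Lemma ncard_eq0 T (A : set T) : (forall x, ~ A x) -> ncard A = 0%N.
Proof.
move=> nA; rewrite -[RHS](card_ord 0); apply: ncard_enumerated.
have f : 'I_0 -> T by case.
by exists f; split=> [[]//|x]; split=> [/nA//|[[]]].
Qed.

Lemma enumerated_has_inj T U (A : set T) (B : set U) N :
  (forall M, has_inj M A <-> has_inj M B) -> enumerated 'I_N A -> enumerated 'I_N B.
Proof. by move=> AB /enumeratedP[h1 h2]; apply/enumeratedP; rewrite -!AB. Qed.

Lemma card_eq_has_inj T U (A : set T) (B : set U) N :
  (forall M, has_inj M A <-> has_inj M B) -> A #= `I_N -> B #= `I_N.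
Proof.
by move=> AB /card_eq_enumerated/(enumerated_has_inj AB)/card_eq_enumerated.
Qed.
End Sizes.

Section Congruence.
Variables (K : fieldType) (d : nat) (W : finType).
Implicit Types rho sigma tau : W -> 'rV[K]_d.

Lemma directly_congruent_refl rho : directly_congruent rho rho.
Proof.
exists 1%:M, 0; split=> [||v]; rewrite ?trmx1 ?mulmx1 ?det1 ?addr0 //.
Qed.

Lemma directly_congruent_sym rho sigma :
  directly_congruent rho sigma -> directly_congruent sigma rho.
Proof.
move=> [A [b [AA dA rs]]]; exists A^T, (- (b *m A^T)); split.
- by rewrite trmxK; apply: mulmx1C.
- by rewrite det_tr.
- by move=> v; rewrite rs mulmxDl -mulmxA AA mulmx1 addrK.
Qed.

Lemma directly_congruent_trans rho sigma tau :
  directly_congruent rho sigma -> directly_congruent sigma tau ->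
  directly_congruent rho tau.
Proof.
move=> [A [b [AA dA rs]]] [B [c [BB dB st]]]; exists (A *m B), (b *m B + c); split.
- by rewrite trmx_mul mulmxA -(mulmxA A) BB mulmx1.
- by rewrite det_mulmx dA dB mulr1.
- by move=> v; rewrite st rs mulmxDl mulmxA addrA.
Qed.

Lemma congruence_class_eq rho sigma :
  [set r | directly_congruent rho r]%classic =
    [set r | directly_congruent sigma r]%classic <-> directly_congruent rho sigma.
Proof.
split=> [e|rs].
  have : [set r | directly_congruent sigma r]%classic sigma.
    exact: directly_congruent_refl.
  by rewrite -e.
apply/seteqP; split=> r /=; apply: directly_congruent_trans => //.
exact: directly_congruent_sym.
Qed.

Lemma directly_congruent_realizations (G : graph W)
    (l : {e : {set W} | e \in edges G} -> K) rho sigma :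
  directly_congruent rho sigma -> realizations l rho -> realizations l sigma.
Proof.
move=> [A [b [AA _ rs]]] rl e u v euv.
by rewrite !rs opprD addrACA subrr addr0 -mulmxBl sqnorm_mulmx //; exact: rl.
Qed.
End Congruence.

(** * Independence of the choice of generic lengths *)

Section ClassesTransfer.
Variables (K : numClosedFieldType) (d : nat) (W : finType) (G : graph W).
Hypothesis uncK : (~ countable [set: K])%classic.
Local Notation E := {e : {set W} | e \in edges G}.
Implicit Types l : E -> K.

(** Independent families [l] and [l'] satisfy only trivial relations, so realizations can be copied
    from [l] to [l']; a congruence between two copies is copied back to the originals. *)
Lemma classes_transfer l l' N : alg_independent l -> alg_independent l' ->
  has_inj N (realization_classes (d := d) l) ->
  has_inj N (realization_classes (d := d) l').
Proof.
move=> li li' [F [Finj FP]].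
have /choice[rho rhoP] k : exists rho : W -> 'rV[K]_d, realizations l rho /\
    F k = [set r | directly_congruent rho r]%classic.
  by have [r rl <-] := FP k; exists r.
pose f : {rmorphism {mpoly rat[#|{: E}|]} -> K} := mmap ratr (fun i => l (enum_val i)).
pose g : {rmorphism {mpoly rat[#|{: E}|]} -> K} := mmap ratr (fun i => l' (enum_val i)).
have fg : same_kernel f g by move=> p; split=> [/li ->|/li' ->]; exact: mmap0.
have lenX e : f 'X_(enum_rank e) = l e /\ g 'X_(enum_rank e) = l' e.
  by rewrite /f /g /= !mmapX !mmap1U enum_rankK.
have [B [f' [g' [i [y [cB fg' f'i g'i f'y]]]]]] := same_kernel_lift uncK
  (fun z : 'I_N * W * 'I_d => rho z.1.1 z.1.2 0 z.2) (countable_mpoly _) fg.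
have {}f'y z : f' (y z) = rho z.1.1 z.1.2 0 z.2 := f'y z.
pose sg k (v : W) : 'rV[K]_d := \row_c g' (y (k, v, c)).
have sgl k : realizations l' (sg k).
  move=> e u v euv.
  have := (fg' (\sum_c (y (k, u, c) - y (k, v, c)) ^+ 2 - i 'X_(enum_rank e))).1.
  rewrite !rmorphB !rmorph_sum /= [f' (i _)]f'i [g' (i _)]g'i.
  rewrite [f _](lenX e).1 [g _](lenX e).2 => h.
  apply/eqP; rewrite -subr_eq0; apply/eqP; rewrite -[RHS]h.
    by congr (_ - _); apply: eq_bigr => c _; rewrite rmorphXn rmorphB !mxE.
  apply/eqP; rewrite subr_eq0; apply/eqP.
  have [rl _] := rhoP k; rewrite -(rl e u v euv); apply: eq_bigr => c _.
  by rewrite rmorphXn rmorphB /= !f'y !mxE.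
exists (fun k => [set r | directly_congruent (sg k) r]%classic).
split=> [k1 k2 /congruence_class_eq [A [b [AA dA sgA]]]|k]; last by exists (sg k).
apply: Finj; rewrite (rhoP k1).2 (rhoP k2).2; apply/congruence_class_eq.
have gf' : same_kernel g' f' by move=> z; split=> /fg'.
(* A second lift, in the reverse direction, adjoins the entries of [A] and [b] over the ring that
   holds all coordinates. *)
have [B2 [g2 [f2 [j [t [_ gf2 g2j f2j g2t]]]]]] := same_kernel_lift uncK
  (fun z : 'I_d * 'I_d + 'I_d => match z with inl p => A p.1 p.2 | inr c => b 0 c end)
  cB gf'.
have {}g2t z : g2 (t z) = match z with inl p => A p.1 p.2 | inr c => b 0 c end := g2t z.
pose M : 'M[B2]_d := \matrix_(p, q) t (inl (p, q)).
pose s : 'rV[B2]_d := \row_c t (inr c).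
have MA : map_mx g2 M = A by apply/matrixP => p q; rewrite !mxE g2t.
have sb : map_mx g2 s = b by apply/rowP => q; rewrite !mxE g2t.
have back (n1 n2 : nat) (X Y : 'M[B2]_(n1, n2)) :
    map_mx g2 X = map_mx g2 Y -> map_mx f2 X = map_mx f2 Y.
  move=> /matrixP XY; apply/matrixP => p q; apply/eqP.
  rewrite !mxE -subr_eq0 -rmorphB; apply/eqP/gf2.
  by rewrite rmorphB; have := XY p q; rewrite !mxE => ->; rewrite subrr.
exists (map_mx f2 M), (map_mx f2 s); split.
- rewrite map_trmx -map_mxM -(map_mx1 f2); apply: back.
  by rewrite map_mxM -map_trmx MA AA map_mx1.
- rewrite det_map_mx; apply/eqP; rewrite -subr_eq0 -(rmorph1 f2) -rmorphB; apply/eqP/gf2.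
  by rewrite rmorphB rmorph1 -det_map_mx MA dA subrr.
- move=> v.
  pose Y k : 'rV[B2]_d := \row_c j (y (k, v, c)).
  have Yf k : map_mx f2 (Y k) = rho k v.
    by apply/rowP => c; rewrite !mxE [f2 _]f2j f'y.
  have Yg k : map_mx g2 (Y k) = sg k v.
    by apply/rowP => c; rewrite !mxE [g2 _]g2j.
  rewrite -!Yf -map_mxM -map_mxD; apply: back.
  by rewrite map_mxD map_mxM !Yg MA sb sgA.
Qed.
End ClassesTransfer.

(** One generic [l] decides for all of them; when its classes are infinite in number, both sides
    take the default 0. *)
Lemma realization_number_ncard (R : realType) d (W : finType) (G : graph W)
    (l : {e : {set W} | e \in edges G} -> R[i]%C) : alg_independent l ->
  realization_number d G R = ncard (realization_classes (d := d) l).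
Proof.
move=> li; rewrite /realization_number /ncard; congr (xget _ _).
apply/seteqP; split=> N /=; first exact.
move=> lN l' li'; apply: card_eq_has_inj lN => M.
by split; apply: classes_transfer => //; exact: complex_uncountable.
Qed.

(** * Classes of realizations fibred over those of a subgraph *)

Section Fibration.
Variables (K : numClosedFieldType) (m : nat) (U W : finType) (j : U -> W).
Variables (GU : graph U) (GW : graph W).
Variables (lU : {e : {set U} | e \in edges GU} -> K).
Variables (l : {e : {set W} | e \in edges GW} -> K).
Local Notation d := (1 + m)%N.
Variables (v0 : U) (fv : 'I_m -> U).
Implicit Types (rho : U -> 'rV[K]_d) (tau : W -> 'rV[K]_d).
Local Notation cls r := [set r' | directly_congruent r r']%classic.

Hypothesis restrict : forall tau, realizations l tau -> realizations lU (tau \o j).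
Hypothesis gramP : forall rho, realizations lU rho -> gram v0 fv rho \in unitmx.
Hypothesis ext_same : forall rho rho' N,
  realizations lU rho -> realizations lU rho' ->
  has_inj N (extensions j l rho) -> has_inj N (extensions j l rho').

(** A congruence between two extensions of [rho] stabilizes [rho], hence is the identity. *)
Lemma extension_rigid rho tau tau' : realizations lU rho ->
  extensions j l rho tau -> extensions j l rho tau' ->
  directly_congruent tau tau' -> tau = tau'.
Proof.
move=> rl [_ tj] [_ tj'] [A [b [AA dA e]]].
have [|A1 b0] := direct_stabilizer (gramP rl) AA dA (b := b).
  by move=> v; rewrite -{1}tj' -tj /= e.
by apply/funext => v; rewrite e A1 b0 mulmx1 addr0.
Qed.

(** With a representative fixed in each class below, the classes above correspond to pairs of a
    representative and one of its extensions. *)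
Lemma ncard_classes rho0 : realizations lU rho0 ->
  ncard (realization_classes (d := d) l) =
  (ncard (realization_classes (d := d) lU) * ncard (extensions j l rho0))%N.
Proof.
move=> rl0.
have dc_j tau tau' : directly_congruent tau tau' ->
    directly_congruent (tau \o j) (tau' \o j).
  by move=> [A [b [AA dA e]]]; exists A, b; split=> // v; rewrite /= e.
(* Without extensions of [rho0], [ext_same] leaves none over any placement, and both sides are 0. *)
have [[tau0 tau0P]|ext0] := pselect (exists tau, extensions j l rho0 tau); last first.
  rewrite [X in (_ * X)%N]ncard_eq0 ?muln0 => [|tau tauP]; last by apply: ext0; exists tau.
  apply: ncard_eq0 => _ [tau tl _]; apply: ext0.
  have [f [_ fP]] : has_inj 1 (extensions j l rho0).
    by apply: ext_same (restrict tl) rl0 _; apply: (has_inj1 (x := tau)).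
  by exists (f ord0).
have ext_ex rho : realizations lU rho -> exists tau, extensions j l rho tau.
  move=> rl; have [f [_ fP]] : has_inj 1 (extensions j l rho).
    by apply: ext_same rl0 rl _; apply: has_inj1 tau0P.
  by exists (f ord0).
have infU N : has_inj N (realization_classes (d := d) lU) ->
    has_inj N (realization_classes (d := d) l).
  move=> [F [Finj FP]].
  have /choice[t tP] k : exists tau, realizations l tau /\ F k = cls (tau \o j).
    by have [r /ext_ex[tau [tl tj]] <-] := FP k; exists tau; rewrite tj.
  exists (fun k => cls (t k)); split=> [k1 k2 /congruence_class_eq/dc_j h|k].
    by apply: Finj; rewrite (tP k1).2 (tP k2).2; apply/congruence_class_eq.
  by exists (t k) => //; exact: (tP k).1.
have infE N : has_inj N (extensions j l rho0) ->
    has_inj N (realization_classes (d := d) l).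
  move=> [t [tinj tP]]; exists (fun k => cls (t k)).
  split=> [k1 k2 /congruence_class_eq h|k].
    by apply: tinj; apply: extension_rigid rl0 (tP k1) (tP k2) h.
  by exists (t k) => //; exact: (tP k).1.
have [[a [F [Finj FP]]]|inf] := enumerated_or_infinite (realization_classes (d := d) lU);
  last first.
  by rewrite (ncard_infinite inf) mul0n ncard_infinite // => N; exact: infU.
have [[b eE]|inf] := enumerated_or_infinite (extensions j l rho0); last first.
  by rewrite (ncard_infinite inf) muln0 ncard_infinite // => N; exact: infE.
rewrite (ncard_enumerated eE) card_ord.
rewrite (ncard_enumerated (F := 'I_a) (A := realization_classes lU)); last by exists F.
have -> : (#|'I_a| * b = #|{: 'I_a * 'I_b}|)%N by rewrite card_prod !card_ord.
apply: ncard_enumerated.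
have /choice[r rP] k : exists rho, realizations lU rho /\ F k = cls rho.
  by have [|rho rl <-] := (FP (F k)).2; [exists k | exists rho].
have /choice[t tP] k : exists t : 'I_b -> W -> 'rV[K]_d, injective t /\
    forall x, extensions j l (r k) x <-> exists i, t i = x.
  apply: (enumerated_has_inj (A := extensions j l rho0)) eE => M.
  by split; apply: ext_same => //; exact: (rP k).1.
have tE k i : extensions j l (r k) (t k i) by apply/(tP k).2; exists i.
exists (fun p => cls (t p.1 p.2)); split=> [[k1 i1] [k2 i2] /= /congruence_class_eq h|x].
  have k12 : k1 = k2.
    apply: Finj; rewrite (rP k1).2 (rP k2).2; apply/congruence_class_eq.
    by have := dc_j _ _ h; rewrite (tE k1 i1).2 (tE k2 i2).2.
  move: h; rewrite -k12 => h; congr pair; apply: (tP k1).1.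
  by apply: extension_rigid (rP k1).1 (tE k1 i1) (tE k1 i2) h.
split=> [[tau tl <-]|[[k i] <-]]; last by exists (t k i) => //; exact: (tE k i).1.
have [|k kP] := (FP (cls (tau \o j))).1; first by exists (tau \o j) => //; exact: restrict.
have [A [b0 [AA dA e]]] : directly_congruent (tau \o j) (r k).
  by apply/congruence_class_eq; rewrite -kP (rP k).2.
(* Moving [tau] by the congruence that takes its restriction to the representative makes it one of
   the enumerated extensions. *)
pose tau' v := tau v *m A + b0.
have tt' : directly_congruent tau tau' by exists A, b0.
have [i iP] : exists i, t k i = tau'.
  apply/(tP k).2; split; first exact: directly_congruent_realizations tt' tl.
  by apply/funext => u; rewrite e.
exists (k, i); rewrite /= iP; apply/congruence_class_eq.
exact: directly_congruent_sym.
Qed.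

Lemma ncard_classes0 : (forall rho, ~ realizations lU rho) ->
  ncard (realization_classes (d := d) l) = 0%N /\
  ncard (realization_classes (d := d) lU) = 0%N.
Proof.
by move=> nr; split; apply: ncard_eq0 => x [tau tl _];
  [case: (nr _ (restrict tl)) | case: (nr _ tl)].
Qed.
End Fibration.

(** * Extensions to the glued graph as families of extensions to the copies *)

Section GlueExtensions.
Variables (K : fieldType) (d k : nat) (V : finType) (G : graph V) (H : subgraph G).
Local Notation VH := {v : V | v \in sverts H}.
Local Notation E := {e : {set V} | e \in edges G}.
Local Notation EG := {e : {set (glue_vert k H)} | e \in edges (glue k H)}.

Lemma copy_edge_proof (i : 'I_k) (e : E) :
  [set copy H i x | x in val e]%SET \in edges (glue k H).
Proof. by apply/bigcupP; exists i => //; apply: imset_f; exact: valP. Qed.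

Definition copy_edge (i : 'I_k) (e : E) : EG := mk_edge (copy_edge_proof i e).

Lemma copy_edge_inj i : injective (copy_edge i).
Proof. by move=> e e' /(congr1 val)/imset_inj-/(_ (@copy_inj _ _ _ H i))/val_inj. Qed.

Lemma copy_val (i : 'I_k) (u : VH) : copy H i (val u) = inl u.
Proof.
rewrite /copy; case: (decP _) => h; last by case: h; exact: valP.
by congr inl; exact: val_inj.
Qed.

Lemma copy_edge_sub i i' (e : {e : {set VH} | e \in edges (graph_of H)}) :
  copy_edge i (edge_of_sub e) = copy_edge i' (edge_of_sub e).
Proof.
apply/val_inj; rewrite /= -!imset_comp; apply: eq_imset => u /=.
by rewrite !copy_val.
Qed.

Lemma realizations_sub (l : E -> K) (tau : V -> 'rV[K]_d) :
  realizations l tau -> realizations (l \o @edge_of_sub V G H) (tau \o val).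
Proof.
move=> tl e u v euv; apply: tl.
by rewrite /= euv imsetU1 imset_set1.
Qed.

Variable l : EG -> K.
Definition arm i : E -> K := l \o copy_edge i.

Lemma realizations_arm i (tau : glue_vert k H -> 'rV[K]_d) :
  realizations l tau -> realizations (arm i) (tau \o copy H i).
Proof.
move=> tl e u v euv; apply: tl.
by rewrite /= euv imsetU1 imset_set1.
Qed.

Definition glued (rho : VH -> 'rV[K]_d) (t : 'I_k -> V -> 'rV[K]_d)
    (x : glue_vert k H) : 'rV[K]_d :=
  match x with inl u => rho u | inr p => t p.1 (val p.2) end.

Lemma glued_copy rho t i v : (forall i, t i \o val = rho) ->
  glued rho t (copy H i v) = t i v.
Proof.
move=> tv; rewrite /copy; case: (decP _) => // h /=.
by rewrite -(tv i).
Qed.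

Lemma sqnormN (x : 'rV[K]_d) : sqnorm (- x) = sqnorm x.
Proof. by apply: eq_bigr => i _; rewrite mxE sqrrN. Qed.

Lemma glued_extension rho t : (forall i, extensions val (arm i) rho (t i)) ->
  extensions inl l rho (glued rho t).
Proof.
move=> tP; split; last by apply/funext.
have tv i : t i \o val = rho by case: (tP i).
move=> e x y exy; have /bigcupP[i _ /imsetP[f fG ef]] : val e \in edges (glue k H).
  exact: valP.
have /cards2P[a [b [ab fab]]] : #|f| == 2%N by rewrite (edges_card2 fG).
have eE : e = copy_edge i (mk_edge fG) by apply: val_inj.
have len : sqnorm (t i a - t i b) = l e.
  by rewrite eE; have [tl _] := tP i; apply: (tl (mk_edge fG) a b).
move: ef; rewrite exy fab imsetU1 imset_set1 => /set2_eq[] [-> ->].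
  by rewrite !glued_copy.
by rewrite !glued_copy // -sqnormN opprB.
Qed.

Lemma extension_arm i (rho : VH -> 'rV[K]_d) tau :
  extensions inl l rho tau -> extensions val (arm i) rho (tau \o copy H i).
Proof.
move=> [tl tj]; split; first exact: realizations_arm.
by rewrite -tj; apply/funext => u; rewrite /= copy_val.
Qed.

(** Every edge lies in some copy, and the copies meet only in [H], so the extensions to the copies
    can be chosen independently. *)
Lemma glue_extensions_enumerated (F : finType) (rho : VH -> 'rV[K]_d) :
  (0 < k)%N -> (forall i, enumerated F (extensions val (arm i) rho)) ->
  enumerated {ffun 'I_k -> F} (extensions inl l rho).
Proof.
move=> k0 /choice[t tP].
have tE i c : extensions val (arm i) rho (t i c) by apply/(tP i).2; exists c.
have tv c : forall i : 'I_k, t i (c i) \o val = rho by move=> i; case: (tE i (c i)).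
exists (fun c : {ffun 'I_k -> F} => glued rho (fun i => t i (c i))).
split=> [c c' e|tau].
  apply/ffunP => i; apply: (tP i).1; apply/funext => v.
  by have := congr1 (@^~ (copy H i v)) e; rewrite !glued_copy.
split=> [tauP|[c <-]]; last by apply: glued_extension.
have /choice[c cP] i : exists c, t i c = tau \o copy H i.
  by apply/(tP i).2; exact: extension_arm.
exists (finfun c); apply/funext => x; have [i [v ->]] := copy_surj x k0.
by rewrite glued_copy // ffunE cP.
Qed.

(** The [c]-th extension is used in every copy at once; distinctness is visible on the first
    copy. *)
Lemma glue_extensions_infinite (rho : VH -> 'rV[K]_d) :
  (0 < k)%N -> (forall i N, has_inj N (extensions val (arm i) rho)) ->
  forall N, has_inj N (extensions inl l rho).
Proof.
move=> k0 inf N; have /choice[t tP] i := inf i N.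
have tv c i : t i c \o val = rho := ((tP i).2 c).2.
exists (fun c => glued rho (fun i => t i c)); split=> [c c' e|c].
  pose i := Ordinal k0; apply: (tP i).1; apply/funext => v.
  have := congr1 (@^~ (copy H i v)) e.
  by rewrite !glued_copy.
by apply: glued_extension => i; exact: (tP i).2.
Qed.
End GlueExtensions.

Theorem theorem3 (R : realType) (d k : nat) (V : finType) (G' : graph V)
    (H : subgraph G') (hd : (1 <= d)%N) (hk : (1 <= k)%N)
    (hG' : min_rigid R d G') (hH : min_rigid R d (graph_of H))
    (hHd : (d <= #|sverts H|)%N) (hG : min_rigid R d (glue k H)) :
  (realization_number d (glue k H) R)%:R =
    (realization_number d (graph_of H) R)%:R *
    ((realization_number d G' R)%:R /
     (realization_number d (graph_of H) R)%:R) ^+ k :> rat.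
Proof.
have [rigH _] := hH; case: d hd hHd rigH {hG' hH hG} => [//|m] _ hHd.
rewrite -[m.+1]/(1 + m)%N in hHd * => rigH.
pose VH := {v : V | v \in sverts H}; pose K : numClosedFieldType := R[i]%C.
have uncK : (~ countable [set: K])%classic by exact: complex_uncountable.
have VHd : (1 + m <= #|{: VH}|)%N by rewrite card_sig.
(* The first [d] vertices of [H]: one origin [v0] and [m] further points for the frame. *)
pose vs (i : 'I_(1 + m)) : VH := enum_val (widen_ord VHd i).
have vs_inj : injective vs.
  by move=> i j /enum_val_inj/(congr1 val) /= e; apply/val_inj.
pose v0 := vs ord0; pose fv (i : 'I_m) := vs (lift ord0 i).
have fv_inj : injective fv by move=> i j /vs_inj/lift_inj.
have fv0 i : fv i != v0 by rewrite (inj_eq vs_inj) eq_sym neq_lift.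
(* A single generic choice on the glued graph: its restrictions to each copy and to [H] remain
   generic, and all copies agree on [H]. *)
have [l li] := exists_alg_independent
  {e : {set (glue_vert k H)} | e \in edges (glue k H)} uncK.
have arm_li i : alg_independent (arm l i) :=
  alg_independent_inj (@copy_edge_inj _ _ _ H i) li.
pose i0 : 'I_k := Ordinal hk.
pose lH := arm l i0 \o @edge_of_sub V G' H.
have lHi : alg_independent lH :=
  alg_independent_inj (@edge_of_sub_inj V G' H) (arm_li i0).
have lHE i : arm l i \o @edge_of_sub V G' H = lH.
  by apply/funext => e; rewrite /lH /arm /= (copy_edge_sub i i0).
have compat i (rho : VH -> 'rV[K]_(1 + m)) :
    realizations lH rho -> compatible (arm l i) rho.
  by move=> rl; split; [exact: arm_li | rewrite lHE].
have ext_same i i' (rho rho' : VH -> 'rV[K]_(1 + m)) N :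
    realizations lH rho -> realizations lH rho' ->
    has_inj N (extensions val (arm l i) rho) -> has_inj N (extensions val (arm l i') rho').
  move=> /(compat i) c /(compat i') c' [t [tinj tP]].
  exact: (extensions_transfer uncK rigH fv_inj fv0 c c' tinj tP).
have gramP (rho : VH -> 'rV[K]_(1 + m)) : realizations lH rho ->
    gram v0 fv rho \in unitmx.
  by move=> /(compat i0); exact: (gram_unit rigH fv_inj fv0).
have subG (tau : V -> 'rV[K]_(1 + m)) : realizations (arm l i0) tau ->
    realizations lH (tau \o val) by exact: realizations_sub.
have subGlue (tau : glue_vert k H -> 'rV[K]_(1 + m)) : realizations l tau ->
    realizations lH (tau \o inl).
  move=> /(realizations_arm i0)/subG; congr (realizations _ _).
  by apply/funext => u; rewrite /= copy_val.
have glue_same (rho rho' : VH -> 'rV[K]_(1 + m)) N :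
    realizations lH rho -> realizations lH rho' ->
    has_inj N (extensions inl l rho) -> has_inj N (extensions inl l rho').
  move=> rl rl'; have [[e eE]|inf] := enumerated_or_infinite (extensions val (arm l i0) rho).
    have en (r : VH -> 'rV[K]_(1 + m)) : realizations lH r ->
        forall i, enumerated 'I_e (extensions val (arm l i) r).
      by move=> rr i; apply: enumerated_has_inj eE => M; split; exact: ext_same.
    have [f [finj fP]] := glue_extensions_enumerated hk (en _ rl).
    have [g [ginj gP]] := glue_extensions_enumerated hk (en _ rl').
    move=> [t [tinj tP]]; have /choice[c cP] n : exists c, f c = t n by apply/fP.
    exists (g \o c); split=> [a b /ginj ab|a]; last by apply/gP; exists (c a).
    by apply: tinj; rewrite -!cP ab.
  move=> _; apply: (glue_extensions_infinite hk) => i M.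
  exact: ext_same rl rl' (inf M).
rewrite (realization_number_ncard (1 + m) li) (realization_number_ncard (1 + m) lHi).
rewrite (realization_number_ncard (1 + m) (arm_li i0)).
(* If [H] has no realization with these lengths, the counts of the glued graph and of [H] are both
   0. *)
have [[rho0 rl0]|nr] := pselect
    (exists rho : VH -> 'rV[K]_(1 + m), realizations lH rho); last first.
  have nr' (rho : VH -> 'rV[K]_(1 + m)) : ~ realizations lH rho.
    by move=> rl; apply: nr; exists rho.
  by have [-> ->] := ncard_classes0 subGlue nr'; rewrite mul0r.
rewrite (ncard_classes subGlue gramP glue_same rl0).
rewrite (ncard_classes subG gramP (fun r r' N => @ext_same i0 i0 r r' N) rl0).
set a := ncard (realization_classes lH).
(* The lengths differ from copy to copy, but by [ext_same] the number of extensions does not. *)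
have -> : ncard (extensions inl l rho0) = (ncard (extensions val (arm l i0) rho0) ^ k)%N.
  have [[e eE]|inf] := enumerated_or_infinite (extensions val (arm l i0) rho0).
    have en i : enumerated 'I_e (extensions val (arm l i) rho0).
      by apply: enumerated_has_inj eE => M; split; exact: ext_same.
    rewrite (ncard_enumerated eE) (ncard_enumerated (glue_extensions_enumerated hk en)).
    by rewrite card_ffun !card_ord.
  rewrite (ncard_infinite inf) exp0n //; apply: ncard_infinite.
  apply: (glue_extensions_infinite hk) => i N.
  exact: (ext_same _ _ _ _ _ rl0 rl0 (inf N)).
have [->|a0] := eqVneq a 0%N; first by rewrite mul0n mul0r.
by rewrite !natrM natrX mulrAC mulfV ?mul1r // pnatr_eq0.
Qed.
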